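(* Let $A\subset\mathbb{N}$ be such that $$\Delta\coloneq\limsup_{x\to\infty}\frac{1}{\log\log x}\sum_{a\in A\cap[2,x]}\frac{1}{a\log a}$$ is positive. Then there exists a strictly increasing infinite divisibility chain $n_0\mid n_1\mid n_2\mid\cdots$ (with $n_0<n_1<n_2<\cdots$) of elements of $A$ such that $$\limsup_{x\to\infty}\frac{1}{\log\log x}\#\{i: n_i\le x\}\ge\Delta.$$
   Context: $\mathbb{N}=\{1,2,3,\dots\}$. (The element $1$, if in $A$, contributes nothing to the sum defining $\Delta$.) *)

(* Defs.v *)
From HB Require Import structures.
From mathcomp Require Import all_boot all_order all_algebra.
From mathcomp Require Import all_classical all_reals all_analysis.
Set Implicit Arguments. Unset Strict Implicit. Unset Printing Implicit Defensive.
Import Order.TTheory GRing.Theory Num.Theory.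
Import numFieldTopology.Exports.
Local Open Scope classical_set_scope.
Local Open Scope ring_scope.

Definition limsup_pinfty (R : realType) (f : R -> R) : \bar R :=
  @limf_esup R R R (fun x : R => (f x)%:E) (pinfty_nbhs R).

Definition harm_log_sum (R : realType) (A : set nat) (x : R) : R :=
  \sum_(2 <= a < (Num.truncn x).+1 | (a \in A) && (a%:R <= x))
     (a%:R * ln (a%:R : R))^-1.

(* #{ i : n_i <= x } for a strictly increasing sequence n (so n_i >= i) *)
Definition count_le (R : realType) (n : nat -> nat) (x : R) : R :=
  (\sum_(0 <= i < (Num.truncn x).+1 | (n i)%:R <= x) 1%N)%:R.

Definition Delta (R : realType) (A : set nat) : \bar R :=
  limsup_pinfty (fun x : R => harm_log_sum A x / ln (ln x)).

(* Main.v *)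
(** The values [n] taken by the increasing family (in the divisibility order)
    of random integers [N_s], [P(N_s = n) = n^-s / zeta(s)], as [s] decreases
    to 1 form a random divisibility chain: from [n] it jumps to [nq] with
    probability [Lambda(q) v(nq) / (ln n * v(n))], and from 1 to [q] with
    probability [Lambda(q) v(q)], where
    [v(n) = \int_1^oo n^-s / zeta(s) ds].  Started at 1 it visits [n] with
    probability [ln n * v(n) ~ 1 / (n ln n)], so the expected number of visits
    to [A] up to [x] is [(Delta + o(1)) ln ln x] along a sequence of [x].

    Call a vertex good if, starting from it, the expected number of visits to
    [A] up to [x] still has limsup at least [Delta] relative to [ln ln x].  From
    a good vertex there is a chain to another good vertex with at least
    [(Delta - e) ln ln y] elements of [A] below some large [y]: otherwise paths
    that stay among good vertices collect at most [(Delta - e) ln ln x], and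
    those that leave do so at a vertex whose limsup is [< Delta].  Visits up to
    [x] are [O(ln ln x)] in mean uniformly in the starting point, so averaging
    over the exit vertex makes the limsup at the starting vertex [< Delta].
    Concatenating such chains with [e -> 0] gives the theorem. *)
Require Import Defs.
From HB Require Import structures.
From mathcomp Require Import all_boot all_order all_algebra.
From mathcomp Require Import all_classical all_reals all_analysis.
From mathcomp Require Import ring lra zify.
Import Order.TTheory GRing.Theory Num.Theory.
Import numFieldNormedType.Exports.
Set Implicit Arguments.
Unset Strict Implicit.
Unset Printing Implicit Defensive.
Local Open Scope classical_set_scope.
Local Open Scope ring_scope.

(** * The von Mangoldt function and partial sums of zeta *)


(** At a prime power p^k only the pair (p, k) contributes, and k < p^k keeps it in range; the
    double-sum form lets divisor sums be exchanged. *)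
Definition mangoldt (R : realType) (d : nat) : R :=
  \sum_(0 <= p < d.+1 | prime p)
    \sum_(1 <= k < d.+1 | (p ^ k)%N == d) ln (p%:R : R).

Lemma mangoldt_ge0 (R : realType) d : 0 <= mangoldt R d.
Proof.
apply: sumr_ge0 => p pp; apply: sumr_ge0 => k _.
by apply: ln_ge0; rewrite ler1n prime_gt0.
Qed.

Lemma mangoldt1 (R : realType) : mangoldt R 1 = 0.
Proof.
rewrite /mangoldt big1// => p pp; rewrite big1_seq // => k.
rewrite mem_index_iota => /andP[/eqP h /andP[k0 _]].
by move: (prime_gt1 pp); case: k k0 h => // k _; rewrite expnS; nia.
Qed.

Lemma sum_multiples (R : realType) (f : nat -> R) (q M : nat) : (0 < q)%N ->
  \sum_(1 <= m < M.+1 | (q %| m)%N) f m = \sum_(1 <= k < (M %/ q).+1) f (q * k)%N.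
Proof.
move=> q0; elim: M => [|M IH]; first by rewrite div0n !big_geq.
rewrite [LHS]big_mkcond big_nat_recr//= -big_mkcond IH divnS //.
case: ifPn => h; last by rewrite addr0.
rewrite add1n [RHS]big_nat_recr//=; congr (_ + f _).
by move: (divnS M q0) (divnK h); rewrite h; nia.
Qed.

Lemma ln_prod_nat (R : realType) (I : Type) (s : seq I) (P : pred I) (F : I -> nat) :
  (forall i, P i -> (0 < F i)%N) ->
  ln ((\prod_(i <- s | P i) F i)%N%:R : R) = \sum_(i <- s | P i) ln ((F i)%:R : R).
Proof.
move=> F0; elim: s => [|x s IH]; first by rewrite !big_nil ln1.
rewrite !big_cons; case: ifPn => // Px.
by rewrite natrM lnM ?IH// posrE ltr0n ?F0 ?prodn_cond_gt0.
Qed.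

(** Each prime p contributes ln p once for every k from 1 to [logn p m], so the factorisation of m
    gives the total. The bound N, free of m, permits exchange with a sum over m. *)
Lemma sum_mangoldt (R : realType) (m N : nat) : (0 < m <= N)%N ->
  \sum_(1 <= d < N.+1 | (d %| m)%N) mangoldt R d = ln (m%:R : R).
Proof.
move=> /andP[m0 mN].
have -> : \sum_(1 <= d < N.+1 | (d %| m)%N) mangoldt R d =
    \sum_(1 <= d < N.+1) \sum_(0 <= p < N.+1 | prime p) \sum_(1 <= k < N.+1)
       (if (d %| m)%N && ((p ^ k)%N == d) then ln (p%:R : R) else 0).
  rewrite big_mkcond; apply: eq_big_nat => d /andP[d0 dN]; case: ifPn => dm; last first.
    by rewrite big1// => p _; rewrite big1.
  rewrite /mangoldt [RHS](big_cat_nat (n:=d.+1))//=.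
  rewrite [X in _ = _ + X]big1_seq ?addr0; last first.
    move=> p; rewrite mem_index_iota => /andP[pp /andP[pd _]].
    rewrite big1_seq // => k /andP[_]; rewrite mem_index_iota => /andP[k0 _].
    case: eqP => // h; suff: (p <= d)%N by lia.
    by rewrite -h -[X in (X <= _)%N]expn1 leq_exp2l// prime_gt1.
  apply: eq_bigr => p pp; rewrite big_mkcond/=.
  rewrite [RHS](big_cat_nat (n:=d.+1))//=.
  rewrite [X in _ = _ + X]big1_seq ?addr0//.
  move=> k /andP[_]; rewrite mem_index_iota => /andP[k0 _].
  case: eqP => // h; suff: (k < d)%N by lia.
  by rewrite -h; apply: ltn_expl; rewrite prime_gt1.
rewrite exchange_big/=.
have -> : ln (m%:R : R) = \sum_(0 <= p < N.+1 | prime p) ln ((p ^ logn p m)%N%:R : R).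
  rewrite -ln_prod_nat; last by move=> p pp; rewrite expn_gt0 prime_gt0.
  congr (ln _%:R); rewrite -{1}(partnT m0) /partn.
  rewrite [RHS]big_mkcond (big_cat_nat (n:=m.+1))//=.
  rewrite [X in _ = (_ * X)%N]big1_seq ?muln1.
    apply: eq_bigr => p _; case: ifPn => // np.
    by rewrite lognE (negbTE np).
  move=> p /andP[_]; rewrite mem_index_iota => /andP[pm _]; case: ifP => // pp.
  by rewrite lognE pp m0/=; case: ifP => // /dvdn_leq; rewrite m0 => /(_ isT); lia.
apply: eq_bigr => p pp; rewrite exchange_big/=.
have ll : (logn p m < N.+1)%N by have := ltn_logl p m0; lia.
rewrite (big_cat_nat (n:=(logn p m).+1))//=.
rewrite [X in _ + X]big1_seq ?addr0; last first.
  move=> k /andP[_]; rewrite mem_index_iota => /andP[km _].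
  rewrite big1// => d _; case: ifPn => // /andP[dm /eqP pd].
  by move: dm; rewrite -pd pfactor_dvdn//; lia.
transitivity (\sum_(1 <= k < (logn p m).+1) ln (p%:R : R)).
  apply: eq_big_nat => k /andP[k0 km].
  have pkm : (p ^ k %| m)%N by rewrite pfactor_dvdn.
  have pk0 : (0 < p ^ k)%N by rewrite expn_gt0 prime_gt0.
  have := dvdn_leq m0 pkm => pkm'.
  rewrite (big_cat_nat (n:=(p ^ k)%N))//=; last by lia.
  rewrite [X in _ + X]big_ltn; last by lia.
  rewrite pkm eqxx/= !big1_seq ?addr0 ?add0r// => d /andP[_]; rewrite mem_index_iota => h;
    by case: ifPn => // /andP[_ /eqP]; lia.
rewrite natrX lnXn ?ltr0n ?prime_gt0//.
by rewrite big_const_nat iter_addr_0 subn1.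
Qed.

(* The variable is [t = s - 1] throughout. *)
Definition zpart (R : realType) (K : nat) (t : R) : R :=
  \sum_(1 <= k < K.+1) expR (- ((1 + t) * ln k%:R)).

Lemma expRNlnM (R : realType) (s : R) (m n : nat) : (0 < m)%N -> (0 < n)%N ->
  expR (- (s * ln (m * n)%:R)) = expR (- (s * ln m%:R)) * expR (- (s * ln n%:R)).
Proof.
by move=> m0 n0; rewrite natrM lnM ?posrE ?ltr0n// -expRD; congr expR; ring.
Qed.

(** Expand ln m on the right as a divisor sum and put m = qk: pairs with q <= Q and k <= K satisfy
    qk <= QK, and the other terms are nonnegative. *)
Lemma mangoldt_conv (R : realType) (Q K : nat) (t : R) :
  (\sum_(1 <= q < Q.+1) mangoldt R q * expR (- ((1 + t) * ln q%:R))) * zpart K t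
  <= \sum_(1 <= m < (Q * K).+1) expR (- ((1 + t) * ln m%:R)) * ln m%:R.
Proof.
set M := (Q * K)%N; set f := fun m : nat => expR (- ((1 + t) * ln (m%:R : R))).
have -> : \sum_(1 <= m < M.+1) f m * ln (m%:R : R) =
   \sum_(1 <= q < M.+1) mangoldt R q * \sum_(1 <= k < (M %/ q).+1) f (q * k)%N.
  transitivity (\sum_(1 <= m < M.+1) \sum_(1 <= q < M.+1)
      (if (q %| m)%N then mangoldt R q * f m else 0)).
    apply: eq_big_nat => m /andP[m0 mM].
    rewrite -(@sum_mangoldt _ m M) ?m0//= mulrC mulr_suml [in LHS]big_mkcond/=.
    by apply: eq_bigr.
  rewrite exchange_big/=; apply: eq_big_nat => q /andP[q0 qM].
  by rewrite -sum_multiples// mulr_sumr [RHS]big_mkcond.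
have [K0|K0] := posnP K.
  rewrite /zpart K0 [X in _ * X]big_geq// mulr0.
  apply: sumr_ge0 => q _; rewrite mulr_ge0 ?mangoldt_ge0// sumr_ge0// => k _.
  exact: expR_ge0.
have QM : (Q.+1 <= M.+1)%N by rewrite ltnS /M leq_pmulr.
rewrite [leRHS](big_cat_nat (n:=Q.+1))//= mulr_suml.
apply: ler_wpDr.
  apply: sumr_ge0 => q _; rewrite mulr_ge0 ?mangoldt_ge0// sumr_ge0// => k _.
  exact: expR_ge0.
apply: ler_sum_nat => q /andP[q0 qQ]; rewrite -mulrA ler_wpM2l ?mangoldt_ge0//.
have KM : (K.+1 <= (M %/ q).+1)%N by rewrite ltnS leq_divRL// /M mulnC leq_mul2r; lia.
rewrite (big_cat_nat (n:=K.+1))//=; apply: ler_wpDr.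
  by apply: sumr_ge0 => k _; exact: expR_ge0.
rewrite /zpart mulr_sumr; apply: ler_sum_nat => k /andP[k0 _].
by rewrite /f expRNlnM.
Qed.

Lemma ln_pred_le (R : realType) (k : nat) : (1 < k)%N ->
  (k%:R : R)^-1 <= ln k%:R - ln k.-1%:R.
Proof.
case: k => [//|[//|k]] _ /=.
have h1 : 0 < (k.+1%:R : R) by rewrite ltr0n.
have h2 : 0 < (k.+2%:R : R) by rewrite ltr0n.
have h3 : 0 < (k.+1%:R / k.+2%:R : R) by rewrite divr_gt0.
have := @le_ln1Dx R (k.+1%:R / k.+2%:R - 1).
rewrite [1 + _]addrC subrK ln_div ?posrE// => /(_ _).
have e : (k.+1%:R / k.+2%:R - 1 : R) = - (k.+2%:R)^-1.
  rewrite -[X in _ - X](@divff _ (k.+2%:R : R)) ?gt_eqF// -mulrBl -(natr1 k.+1).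
  by rewrite opprD addrA subrr sub0r mulN1r.
rewrite e => H; rewrite -opprB lerNr; apply: H.
by rewrite ltrN2 invf_lt1// ltr1n.
Qed.

Lemma ln_succ_le (R : realType) (k : nat) : (0 < k)%N ->
  ln k.+1%:R - ln k%:R <= (k%:R : R)^-1.
Proof.
move=> k0; have h1 : 0 < (k%:R : R) by rewrite ltr0n.
rewrite -ln_div ?posrE ?ltr0n//.
have -> : (k.+1%:R / k%:R : R) = 1 + k%:R^-1.
  by rewrite -(natr1 k); field; rewrite gt_eqF.
apply: le_ln1Dx; rewrite (lt_trans (ltrN10 R))//; by rewrite invr_gt0.
Qed.

Lemma zpart_le (R : realType) K (t : R) : 0 < t -> t * zpart K t <= 1 + t.
Proof.
move=> t0; rewrite /zpart.
(* Integral test by telescoping: t times the term at k >= 2 is at most the drop of k^-t, so keeping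
   the tail (K+1)^-t closes the induction. *)
suff: t * zpart K.+1 t <= 1 + t - expR (- (t * ln K.+1%:R)).
  have: zpart K t <= zpart K.+1 t.
    by rewrite /zpart [leRHS]big_nat_recr//= lerDl expR_ge0.
  have := expR_ge0 (- (t * ln (K.+1%:R : R))); rewrite /zpart; nra.
elim: K => [|K IH]; rewrite /zpart big_nat_recr//=.
  by rewrite big_geq// ln1 !mulr0 oppr0 expR0; lra.
rewrite mulrDr; move: IH; rewrite /zpart; set S := \sum_(_ <= _ < _) _ => IH.
suff : t * expR (- ((1 + t) * ln (K.+2%:R : R))) <=
   expR (- (t * ln K.+1%:R)) - expR (- (t * ln K.+2%:R)) by lra.
have -> : expR (- ((1 + t) * ln (K.+2%:R : R))) =
   K.+2%:R^-1 * expR (- (t * ln K.+2%:R)).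
  by rewrite mulrDl mul1r opprD expRD [expR (- ln _)]expRN lnK// posrE ltr0n.
have -> : expR (- (t * ln K.+1%:R)) =
   expR (t * (ln K.+2%:R - ln K.+1%:R)) * expR (- (t * ln (K.+2%:R : R))).
  by rewrite -expRD; congr expR; ring.
have h := @ln_pred_le R K.+2 isT; rewrite /= in h.
have h2 := @expR_ge1Dx R (t * (ln K.+2%:R - ln K.+1%:R)).
have := expR_gt0 (- (t * ln (K.+2%:R : R))).
set e := expR (- _) in h2 *; set g := expR (t * _) in h2 *.
set d := ln _ - ln _ in h h2 *; set u := _^-1 in h *.
move=> e0; have: t * u <= t * d by rewrite ler_wpM2l// ltW.
move=> ?; have : t * u <= g - 1 by lra.
by nra.
Qed.

Lemma zpart_ge (R : realType) K (t : R) : 0 < t ->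
  1 - expR (- (t * ln K.+1%:R)) <= t * zpart K t.
Proof.
move=> t0; elim: K => [|K IH]; rewrite /zpart.
  by rewrite big_geq// ln1 !mulr0 oppr0 expR0 subrr.
rewrite big_nat_recr//=; move: IH; rewrite /zpart.
set S := \sum_(_ <= _ < _) _ => IH; rewrite mulrDr.
suff : expR (- (t * ln (K.+1%:R : R))) - expR (- (t * ln K.+2%:R)) <=
  t * expR (- ((1 + t) * ln (K.+1%:R : R))) by lra.
have -> : expR (- ((1 + t) * ln (K.+1%:R : R))) =
   K.+1%:R^-1 * expR (- (t * ln K.+1%:R)).
  by rewrite mulrDl mul1r opprD expRD [expR (- ln _)]expRN lnK// posrE ltr0n.
have -> : expR (- (t * ln K.+2%:R)) =
   expR (- (t * (ln K.+2%:R - ln K.+1%:R))) * expR (- (t * ln (K.+1%:R : R))).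
  by rewrite -expRD; congr expR; ring.
have h := @ln_succ_le R K.+1 isT.
have h2 := @expR_ge1Dx R (- (t * (ln K.+2%:R - ln K.+1%:R))).
have := expR_gt0 (- (t * ln (K.+1%:R : R))).
set e := expR (- (t * ln _)) in h2 *; set g := expR (- (t * (_ - _))) in h2 *.
set d := ln _ - ln _ in h h2 *; set u := _^-1 in h *.
move=> e0; have: t * d <= t * u by rewrite ler_wpM2l// ltW.
move=> ?; have : 1 - g <= t * u by lra.
by nra.
Qed.

(** * The reciprocal of zeta on (1, +oo) *)


(* [1 / zeta(1 + t)], extended by its limit 0 at the pole. *)
Definition inv_zeta (R : realType) (t : R) : R :=
  if t <= 0 then 0 else (sup (range (fun K => zpart K t)))^-1.

Lemma zpart_has_sup (R : realType) (t : R) : 0 < t ->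
  has_sup (range (fun K => zpart K t)).
Proof.
move=> t0; split; first by exists (zpart 0 t), 0%N.
exists ((1 + t) / t) => _ [K _ <-].
by rewrite ler_pdivlMr// mulrC zpart_le.
Qed.

Lemma zpart_le_sup (R : realType) (t : R) K : 0 < t ->
  zpart K t <= sup (range (fun K => zpart K t)).
Proof.
by move=> t0; apply: ub_le_sup; [have [] := zpart_has_sup t0|exists K].
Qed.

Lemma zeta_ge1 (R : realType) (t : R) : 0 < t ->
  1 <= sup (range (fun K => zpart K t)).
Proof.
move=> t0; apply: le_trans (zpart_le_sup 1 t0).
by rewrite /zpart big_nat1 ln1 mulr0 oppr0 expR0.
Qed.

Lemma inv_zeta_ge0 (R : realType) (t : R) : 0 <= inv_zeta t.
Proof.
rewrite /inv_zeta; case: ifPn => //; rewrite -ltNge => t0.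
by rewrite invr_ge0 (le_trans ler01)// zeta_ge1.
Qed.

Lemma inv_zeta_le1 (R : realType) (t : R) : inv_zeta t <= 1.
Proof.
rewrite /inv_zeta; case: ifPn => [_|]; first exact: ler01.
by rewrite -ltNge => t0; rewrite invf_le1 ?zeta_ge1// (lt_le_trans ltr01)// zeta_ge1.
Qed.

Lemma inv_zeta_ge (R : realType) (t : R) : 0 < t -> t / (1 + t) <= inv_zeta t.
Proof.
move=> t0; rewrite /inv_zeta [t <= 0]leNgt t0/=.
rewrite -[leLHS]invrK lef_pV2 ?posrE; last 2 first.
- by rewrite invr_gt0 divr_gt0// addr_gt0.
- by rewrite (lt_le_trans ltr01)// zeta_ge1.
rewrite invf_div; apply: ge_sup; first by have [] := zpart_has_sup t0.
by move=> _ [K _ <-]; rewrite ler_pdivlMr// mulrC zpart_le.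
Qed.

Lemma inv_zeta_le (R : realType) (t : R) : 0 <= t -> inv_zeta t <= t.
Proof.
move=> t0; rewrite /inv_zeta; case: ifPn => //; rewrite -ltNge => {}t0.
rewrite -[leRHS]invrK lef_pV2 ?posrE ?invr_gt0//; last first.
  by rewrite (lt_le_trans ltr01)// zeta_ge1.
rewrite leNgt; apply/negP => h.
have [K hK] : exists K : nat, t^-1 < K%:R.
  exists (Num.truncn t^-1).+1.
  exact: truncnS_gt.
set z := sup _ in h.
have d0 : 0 < 1 - t * z.
  by rewrite subr_gt0 mulrC -ltr_pdivlMr// mul1r.
(* N is so large that the tail (N+1)^-t falls below 1 - tz, contradicting [zpart_ge]. *)
have [N hN] : exists N : nat, - ln (1 - t * z) < t * ln (N.+1%:R : R).
  exists (Num.truncn (expR (- ln (1 - t * z) / t))).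
  rewrite -ltr_pdivrMl// mulrC -[ltLHS]expRK ltr_ln ?posrE ?expR_gt0//.
  exact: truncnS_gt.
have := zpart_ge N t0.
have : expR (- (t * ln (N.+1%:R : R))) < 1 - t * z.
  by rewrite -[ltRHS]lnK ?posrE// ltr_expR; lra.
have : t * zpart N t <= t * z by rewrite ler_wpM2l ?(ltW t0)//; exact: zpart_le_sup.
lra.
Qed.

(* Logarithmic derivative in integrated form: both sides of [ln = Lambda * 1]
   are compared through partial sums, so no term-by-term differentiation of
   zeta is needed. *)
Lemma inv_zeta_step (R : realType) (Q : nat) (t h : R) : 0 <= t -> 0 <= h ->
  (1 + h * \sum_(1 <= q < Q.+1) mangoldt R q * expR (- ((1 + t + h) * ln q%:R)))
    * inv_zeta t <= inv_zeta (t + h).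
Proof.
move=> t0 h0; set S := \sum_(_ <= _ < _) _.
move: t0; rewrite le_eqVlt => /orP[/eqP <-|t0].
  by rewrite [in leLHS]/inv_zeta lexx mulr0 inv_zeta_ge0.
have th0 : 0 < t + h by lra.
rewrite /inv_zeta [t <= 0]leNgt t0/= [t + h <= 0]leNgt th0/=.
set z := sup _; set z' := sup _.
have z1 : 1 <= z by exact: zeta_ge1.
have z'1 : 1 <= z' by exact: zeta_ge1.
have S0 : 0 <= S.
  by apply: sumr_ge0 => q _; rewrite mulr_ge0 ?mangoldt_ge0 ?expR_ge0.
have hS : 0 < 1 + h * S by have := mulr_ge0 h0 S0; lra.
rewrite ler_pdivrMr; last by lra.
rewrite [z'^-1 * z]mulrC ler_pdivlMr; last by lra.
rewrite -ler_pdivlMl// mulrC.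
apply: ge_sup; first by have [] := zpart_has_sup th0.
move=> _ [K _ <-]; rewrite ler_pdivlMr//.
(* Taking [maxn 1 Q] ensures K <= M even when Q = 0. *)
apply: le_trans (zpart_le_sup (maxn 1 Q * K) t0).
set M := (_ * K)%N.
have zM : zpart K (t + h) <= zpart M (t + h).
  rewrite [leRHS]/zpart (big_cat_nat (n:=K.+1))//=; last by rewrite ltnS leq_pmull// leq_max.
  by rewrite lerDl sumr_ge0// => k _; rewrite expR_ge0.
(* The bound e^x >= 1 + x, applied termwise, replaces differentiation in s. *)
have : zpart M (t + h) + h * \sum_(1 <= m < M.+1)
    expR (- ((1 + (t + h)) * ln m%:R)) * ln m%:R <= zpart M t.
  rewrite /zpart mulr_sumr -big_split/=; apply: ler_sum_nat => m /andP[m0 _].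
  have -> : expR (- ((1 + t) * ln (m%:R : R))) =
     expR (h * ln m%:R) * expR (- ((1 + (t + h)) * ln m%:R)).
    by rewrite -expRD; congr expR; ring.
  have := @expR_ge1Dx R (h * ln m%:R).
  have := expR_gt0 (- ((1 + (t + h)) * ln (m%:R : R))).
  set e := expR (- _); set f := expR (_ * _); nra.
have := @mangoldt_conv R (maxn 1 Q) K (t + h); rewrite -/M.
set X := \sum_(1 <= m < M.+1) _.
have : S <= \sum_(1 <= q < (maxn 1 Q).+1) mangoldt R q * expR (- ((1 + (t + h)) * ln q%:R)).
  rewrite /S (big_cat_nat (n:=Q.+1) (p:=(maxn 1 Q).+1))//=; last by rewrite ltnS leq_max leqnn orbT.
  rewrite addrA lerDl sumr_ge0// => q _.
  by rewrite mulr_ge0 ?mangoldt_ge0 ?expR_ge0.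
set S' := \sum_(1 <= q < (maxn 1 Q).+1) _ => SS' h1 h2.
have zK0 : 0 <= zpart K (t + h) by apply: sumr_ge0 => k _; exact: expR_ge0.
have : S * zpart K (t + h) <= S' * zpart K (t + h) by rewrite ler_wpM2r.
move=> h3; have : h * (S * zpart K (t + h)) <= h * X by rewrite ler_wpM2l//; lra.
lra.
Qed.

(** * Riemann sums of n^-s / zeta(s) *)


Definition mesh (R : realType) (N : nat) : R := (2 ^+ N)^-1.

(* Riemann sum for the integral of [n^-s / zeta(s)] over
   [1 + i0 2^-N <= s < 1 + 2^N]. *)
Definition rsum (R : realType) (N i0 n : nat) : R :=
  mesh R N * \sum_(i0 <= i < 4 ^ N)
    expR (- ((1 + i%:R * mesh R N) * ln n%:R)) * inv_zeta (i%:R * mesh R N).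

Lemma mesh_gt0 (R : realType) N : 0 < mesh R N.
Proof. by rewrite invr_gt0 exprn_gt0. Qed.

Lemma mesh_le1 (R : realType) N : mesh R N <= 1.
Proof. by rewrite invf_le1 ?exprn_gt0// exprn_ege1// ler1n. Qed.

Lemma mesh4 (R : realType) N : (4 ^ N)%:R * mesh R N = 2 ^+ N.
Proof.
rewrite /mesh (_ : 4 = 2 * 2)%N// expnMn natrM natrX mulfK//.
Qed.

Lemma rsum_ge0 (R : realType) N i0 n : 0 <= rsum R N i0 n.
Proof.
rewrite mulr_ge0 ?(ltW (mesh_gt0 _ _))// sumr_ge0// => i _.
by rewrite mulr_ge0 ?expR_ge0 ?inv_zeta_ge0.
Qed.

Lemma rsum_mono (R : realType) N i0 n : rsum R N i0 n <= rsum R N 0 n.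
Proof.
rewrite ler_wpM2l ?(ltW (mesh_gt0 _ _))//.
have t0 i : 0 <= expR (- ((1 + i%:R * mesh R N) * ln n%:R)) * inv_zeta (i%:R * mesh R N).
  by rewrite mulr_ge0 ?expR_ge0 ?inv_zeta_ge0.
have [h|h] := leqP i0 (4 ^ N); last by rewrite big_geq ?sumr_ge0// ltnW.
by rewrite [leRHS](big_cat_nat (n:=i0))//= lerDr sumr_ge0.
Qed.

(* Discrete form of [sum_q Lambda(q) v(nq) <= ln n * v(n)]: bound the sum over
   [q] by an increment of [inv_zeta], then sum by parts over the mesh. *)
Lemma rsum_mangoldt (R : realType) (N i0 n Q : nat) :
  (0 < n)%N -> (i0 <= 4 ^ N)%N ->
  \sum_(1 <= q < Q.+1) mangoldt R q * expR (- (mesh R N * ln q%:R)) * rsum R N i0 (n * q)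
  <= expR (mesh R N * ln n%:R) * (ln n%:R * rsum R N i0 n
      - expR (- ((1 + i0%:R * mesh R N) * ln n%:R)) * inv_zeta (i0%:R * mesh R N)
      + expR (- (2 ^+ N * ln n%:R))).
Proof.
move=> n0 i0J; set h := mesh R N; set J := (4 ^ N)%N.
have h0 : 0 < h by exact: mesh_gt0.
set L : R := ln n%:R.
have L0 : 0 <= L by rewrite ln_ge0// ler1n.
set E := expR (h * L).
pose g i := expR (- ((1 + i%:R * h) * L)).
pose B i : R := inv_zeta (i%:R * h).
have -> : rsum R N i0 n = h * \sum_(i0 <= i < J) g i * B i by [].
set S := \sum_(i0 <= i < J) g i * B i.
have gS i : g i = E * g i.+1.
  by rewrite /g /E -expRD; congr expR; rewrite -(natr1 i); ring.
have tele : \sum_(i0 <= i < J) g i.+1 * B i.+1 = S - g i0 * B i0 + g J * B J.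
  have := telescope_sumr (fun i => g i * B i) i0J.
  by rewrite sumrB -/S => /eqP; rewrite subr_eq => /eqP ->; ring.
have step : \sum_(1 <= q < Q.+1) mangoldt R q * expR (- (h * ln q%:R)) * rsum R N i0 (n * q)
   <= \sum_(i0 <= i < J) g i * (B i.+1 - B i).
  have -> : \sum_(1 <= q < Q.+1) mangoldt R q * expR (- (h * ln q%:R)) * rsum R N i0 (n * q)
    = \sum_(i0 <= i < J) \sum_(1 <= q < Q.+1)
      (g i * B i * (h * (mangoldt R q * expR (- ((1 + i%:R * h + h) * ln q%:R))))).
    rewrite exchange_big/=; apply: eq_big_nat => q /andP[q0 _].
    rewrite /rsum -/h mulrA mulr_sumr; apply: eq_bigr => i _.
    rewrite expRNlnM// -/(g i) -/(B i).
    have -> : expR (- ((1 + i%:R * h + h) * ln (q%:R : R))) =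
      expR (- (h * ln q%:R)) * expR (- ((1 + i%:R * h) * ln q%:R)).
      by rewrite -expRD; congr expR; ring.
    by ring.
  apply: ler_sum_nat => i _; rewrite -mulr_sumr -mulr_sumr.
  rewrite -[leLHS]mulrA ler_wpM2l ?expR_ge0//.
  have := @inv_zeta_step R Q (i%:R * h) h.
  have -> : i%:R * h + h = i.+1%:R * h by rewrite -(natr1 i); ring.
  rewrite -/(B i.+1) -/(B i).
  rewrite (mulr_ge0 _ (ltW h0))// (ltW h0) => /(_ isT isT).
  by set X := h * _; lra.
apply: (le_trans step).
have -> : \sum_(i0 <= i < J) g i * (B i.+1 - B i) =
    E * \sum_(i0 <= i < J) g i.+1 * B i.+1 - S.
  rewrite mulr_sumr -sumrB; apply: eq_bigr => i _.
  by rewrite mulrBr {1}gS mulrA.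
rewrite tele.
have gJ : g J * B J <= expR (- (2 ^+ N * L)).
  apply: (@le_trans _ _ (g J)).
    by rewrite -[leRHS]mulr1 ler_wpM2l ?expR_ge0 ?inv_zeta_le1.
  rewrite ler_expR lerN2 mesh4 mulrDl mul1r lerDr//.
have S0 : 0 <= S.
  by apply: sumr_ge0 => i _; rewrite mulr_ge0 ?expR_ge0 ?inv_zeta_ge0.
have E0 : 0 < E by exact: expR_gt0.
have E1 : E - 1 <= E * (h * L).
  have := @expR_ge1Dx R (- (h * L)); rewrite expRN -/E => H.
  have : E * (1 - h * L) <= E * E^-1 by rewrite ler_wpM2l// ltW.
  by rewrite divff ?gt_eqF//; lra.
have : (E - 1) * S <= E * (h * L) * S by rewrite ler_wpM2r.
have : E * (g J * B J) <= E * expR (- (2 ^+ N * L)) by rewrite ler_wpM2l// ltW.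
rewrite -/(B i0) -/(g i0).
by set x := g J * B J; set y := g i0 * B i0; set z := expR (- _); lra.
Qed.

(** * Closed geometric sums and two-sided bounds for the Riemann sums *)

Lemma sum_geom1 (R : realType) (r : R) J :
  (1 - r) ^+ 2 * (\sum_(0 <= i < J) i%:R * r ^+ i) = r - J%:R * r ^+ J + (J%:R - 1) * r ^+ J.+1.
Proof.
elim: J => [|J IH]; first by rewrite big_geq// expr1 expr0; ring.
by rewrite big_nat_recr//= mulrDr IH -(natr1 J) !exprS; ring.
Qed.

Lemma sum_geom2 (R : realType) (r : R) J :
  (1 - r) ^+ 3 * (\sum_(0 <= i < J) i%:R ^+ 2 * r ^+ i) =
  r * (1 + r) - r ^+ J * (J%:R ^+ 2 * (1 - r) ^+ 2 + 2 * J%:R * r * (1 - r) + r * (1 + r)).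
Proof.
elim: J => [|J IH]; first by rewrite big_geq// expr0; ring.
by rewrite big_nat_recr//= mulrDr IH -(natr1 J) !exprS; ring.
Qed.

Lemma expR_geom (R : realType) (N i n : nat) : (0 < n)%N ->
  expR (- ((1 + i%:R * mesh R N) * ln n%:R)) =
  n%:R^-1 * expR (- (mesh R N * ln n%:R)) ^+ i.
Proof.
move=> n0; rewrite mulrDl mul1r opprD expRD [expR (- ln _)]expRN lnK ?posrE ?ltr0n//.
by rewrite -expRM_natl; congr (_ * expR _); ring.
Qed.

(** Since 1/zeta(1+t) <= t, the sum is dominated by one for the integral of t n^(-1-t), which is
    1/(n ln^2 n); the factor 4 covers the discretisation for all N at once. *)
Lemma rsum_le (R : realType) (N n : nat) : (1 < n)%N ->
  rsum R N 0 n <= 4 / (n%:R * ln n%:R ^+ 2).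
Proof.
move=> n1; have n0 : (0 < n)%N by lia.
have L0 : 0 < ln (n%:R : R) by rewrite ln_gt0// ltr1n.
have h0 := mesh_gt0 R N.
set h := mesh R N in h0 *; set L := ln _ in L0 *.
set r := expR (- (h * L)).
have r0 : 0 < r by exact: expR_gt0.
have x0 : 0 < h * L by rewrite mulr_gt0.
have r1 : r * (1 + h * L) <= 1.
  have := @expR_ge1Dx R (h * L) => H.
  rewrite /r expRN ler_pdivrMl ?expR_gt0// mulr1//.
(* e^x is the square of e^(x/2) >= 1 + x/2, and (1 + x)^2 <= 4 (1 + x/2)^2. *)
have r2 : r * (1 + h * L) ^+ 2 <= 4.
  have := @expR_ge1Dx R (h * L / 2) => H.
  have e : r * expR (h * L / 2) ^+ 2 = 1.
    rewrite /r -expRM_natl -expRD (_ : - _ + _ = 0) ?expR0//; by field.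
  have e' : 4 = r * (4 * expR (h * L / 2) ^+ 2) by rewrite mulrCA e mulr1.
  rewrite [leRHS]e' ler_wpM2l ?(ltW r0)//.
  by nra.
apply: (@le_trans _ _ (n%:R^-1 * (h ^+ 2 * (\sum_(0 <= i < 4 ^ N) i%:R * r ^+ i)))).
  rewrite /rsum -/h mulrCA mulr_sumr [leRHS]mulrA mulr_sumr.
  apply: ler_sum_nat => i _; rewrite expR_geom// -/h -/L -/r.
  have ih : 0 <= i%:R * h by rewrite mulr_ge0// ltW.
  have := inv_zeta_le ih.
  have : 0 <= h * (n%:R^-1 * r ^+ i).
    by rewrite !mulr_ge0// ?exprn_ge0// ltW.
  set b := inv_zeta _; set m : R := n%:R^-1; set ri := r ^+ i => H1 H2.
  have : h * (m * ri) * b <= h * (m * ri) * (i%:R * h) by rewrite ler_wpM2l.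
  by lra.
rewrite invfM [leRHS]mulrCA ler_wpM2l ?invr_ge0//.
have d0 : 0 < 1 - r by rewrite subr_gt0 /r expR_lt1 oppr_lt0.
rewrite -(ler_pM2l (exprn_gt0 2 d0)) mulrCA sum_geom1.
set J := (4 ^ N)%N.
have -> : (1 - r) ^+ 2 * (4 / L ^+ 2) = h ^+ 2 * (4 * ((1 - r) / (h * L)) ^+ 2).
  by field; rewrite !gt_eqF.
rewrite ler_wpM2l ?sqr_ge0//.
have : r <= 4 * ((1 - r) / (h * L)) ^+ 2.
  rewrite expr_div_n mulrA ler_pdivlMr ?exprn_gt0//.
  have : h * L * r <= 1 - r by lra.
  move: r2; set x := h * L in x0 r1 *; nra.
have rJ : 0 < r ^+ J by rewrite exprn_gt0.
have : 0 <= J%:R * r ^+ J * (1 - r) by rewrite !mulr_ge0// ltW.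
have : 0 < r ^+ J * r by rewrite mulr_gt0.
rewrite [r ^+ J.+1]exprSr; set rj := r ^+ J; set y := (_ / _) ^+ 2; set j : R := J%:R.
by move=> *; lra.
Qed.

(** From 1/zeta(1+t) >= t/(1+t) >= t - t^2: the two powers integrate to 1/ln^2 n and 2/ln^3 n up to
    the factor 1/n, and all corrections in [mesh] vanish in the limit. *)
Lemma rsum_ge (R : realType) (N n : nat) : (1 < n)%N ->
  n%:R^-1 * ((expR (- (mesh R N * ln n%:R)) - mesh R N * (27 / ln n%:R ^+ 3)) / ln n%:R ^+ 2
    - 2 * (1 + mesh R N * ln n%:R) ^+ 3 / ln n%:R ^+ 3) <= rsum R N 0 n.
Proof.
move=> n1; have n0 : (0 < n)%N by lia.
have L0 : 0 < ln (n%:R : R) by rewrite ln_gt0// ltr1n.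
have h0 := mesh_gt0 R N.
set h := mesh R N in h0 *; set L := ln _ in L0 *.
set r := expR (- (h * L)).
have r0 : 0 < r by exact: expR_gt0.
have x0 : 0 < h * L by rewrite mulr_gt0.
have r1 : r * (1 + h * L) <= 1.
  have := @expR_ge1Dx R (h * L) => H.
  rewrite /r expRN ler_pdivrMl ?expR_gt0// mulr1//.
have rx : 1 - r <= h * L by have := @expR_ge1Dx R (- (h * L)); rewrite -/r; lra.
have d0 : 0 < 1 - r by rewrite subr_gt0 /r expR_lt1 oppr_lt0.
set J := (4 ^ N)%N.
apply: (@le_trans _ _ (n%:R^-1 * (h ^+ 2 * (\sum_(0 <= i < J) i%:R * r ^+ i)
    - h ^+ 3 * (\sum_(0 <= i < J) i%:R ^+ 2 * r ^+ i)))); last first.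
  rewrite /rsum -/h !mulr_sumr -sumrB mulr_sumr.
  apply: ler_sum_nat => i _; rewrite expR_geom// -/h -/L -/r.
  have ih : 0 <= i%:R * h by rewrite mulr_ge0// ltW.
  have : i%:R * h - (i%:R * h) ^+ 2 <= inv_zeta (i%:R * h).
    move: ih; rewrite le_eqVlt => /orP[/eqP <-|ih].
      by rewrite expr0n/= subrr inv_zeta_ge0.
    apply: le_trans (inv_zeta_ge ih).
    by rewrite ler_pdivlMr ?addr_gt0//; set y := i%:R * h in ih *; nra.
  have : 0 <= h * (n%:R^-1 * r ^+ i).
    by rewrite !mulr_ge0// ?exprn_ge0// ltW.
  set b := inv_zeta _; set m : R := n%:R^-1; set ri := r ^+ i => H1 H2.
  have : h * (m * ri) * (i%:R * h - (i%:R * h) ^+ 2) <= h * (m * ri) * b by rewrite ler_wpM2l.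
  by lra.
rewrite ler_wpM2l ?invr_ge0//; apply: lerB.
  (* With y = L/h one has J r^J = h^-2 e^-y, and e^y >= (y/3)^3 produces the 27. *)
  have Jr : J%:R * r ^+ J <= h * (27 / L ^+ 3).
    have -> : r ^+ J = expR (- (2 ^+ N * L)).
      by rewrite -expRM_natl -(mesh4 R N) -/J -/h; congr expR; ring.
    have yh : 2 ^+ N = h^-1 by rewrite /h /mesh invrK.
    have -> : J%:R = h^-1 ^+ 2 :> R.
      by rewrite -yh /J -exprM mulnC exprM -natrX natrX -natrX.
    rewrite yh expRN.
    have := @expR_ge1Dx R (h^-1 * L / 3).
    have y0 : 0 < h^-1 * L by rewrite mulr_gt0 ?invr_gt0.
    set y := h^-1 * L in y0 *; set e3 := expR (y / 3) => H.
    have -> : expR y = e3 ^+ 3 by rewrite /e3 -expRM_natl; congr expR; field.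
    have ye : (y / 3) ^+ 3 <= e3 ^+ 3.
      by rewrite lerXn2r ?nnegrE ?expR_ge0 ?divr_ge0 ?(ltW y0)//; lra.
    have e0 : 0 < e3 ^+ 3 by rewrite exprn_gt0// expR_gt0.
    rewrite ler_pdivrMr//.
    apply: (@le_trans _ _ (h * (27 / L ^+ 3) * (y / 3) ^+ 3)).
      by rewrite /y le_eqVlt; apply/orP; left; apply/eqP; field; rewrite !gt_eqF.
    by rewrite ler_wpM2l// !mulr_ge0 ?invr_ge0 ?exprn_ge0// ltW.
  have hL : L ^- 2 = h ^+ 2 * (h * L) ^- 2 by field; rewrite !gt_eqF.
  have [neg|pos] := leP (r - h * (27 / L ^+ 3)) 0.
    apply: (@le_trans _ _ 0).
      by rewrite mulr_le0_ge0// invr_ge0 sqr_ge0.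
    rewrite mulr_ge0 ?sqr_ge0// sumr_ge0// => i _.
    by rewrite mulr_ge0// exprn_ge0// ltW.
  rewrite hL mulrCA ler_wpM2l ?sqr_ge0// ler_pdivrMr ?exprn_gt0//.
  apply: (@le_trans _ _ ((1 - r) ^+ 2 * (\sum_(0 <= i < J) i%:R * r ^+ i))).
    rewrite sum_geom1.
    suff : 0 <= (J%:R - 1) * r ^+ J.+1 by lra.
    by rewrite mulr_ge0 ?exprn_ge0 ?(ltW r0)// subr_ge0 ler1n expn_gt0.
  rewrite mulrC ler_wpM2l//.
    by apply: sumr_ge0 => i _; rewrite mulr_ge0// exprn_ge0// ltW.
  by rewrite lerXn2r ?nnegrE ?(ltW d0) ?(ltW x0).
have hL : L ^- 3 = h ^+ 3 * (h * L) ^- 3 by field; rewrite !gt_eqF.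
rewrite hL mulrCA ler_wpM2l ?exprn_ge0 ?(ltW h0)//.
rewrite -(ler_pM2l (exprn_gt0 3 d0)) sum_geom2.
apply: (@le_trans _ _ (r * (1 + r))).
  rewrite lerBlDr lerDl mulr_ge0 ?exprn_ge0 ?(ltW r0)//.
  by rewrite !addr_ge0 ?mulr_ge0 ?(ltW d0) ?(ltW r0) ?sqr_ge0 ?addr_ge0 ?(ltW r0).
have x1 : h * L <= (1 - r) * (1 + h * L) by lra.
apply: (@le_trans _ _ 2); first by nra.
rewrite mulrA ler_pdivlMr ?exprn_gt0// [(1 - r) ^+ 3 * _]mulrCA ler_wpM2l// -exprMn.
by rewrite lerXn2r ?nnegrE ?(ltW x0) ?(le_trans (ltW x0)).
Qed.

(** * The weights of the walk *)


Lemma ultra_bounded_cvg (R : realType) (T : Type) (U : set_system T) (u : T -> R) (B : R) :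
  UltraFilter U -> (forall x, 0 <= u x <= B) -> cvg (u @ U).
Proof.
move=> UU uB.
have ux : U (u @^-1` `[0, B]%classic).
  by apply: filterS filterT => x _ /=; rewrite in_itv/= uB.
have [l [_ ul]] := @segment_compact R 0 B (u @ U) _ ux.
apply/cvg_ex; exists l => A lA.
have [//|nA] := in_ultra_setVsetC (u @^-1` A) UU.
have [y [/= Ay]] := ul _ _ (nA : (u @ U) (~` A)) lA.
by [].
Qed.

Lemma cvg_mesh (R : realType) : mesh R N @[N --> \oo] --> (0 : R).
Proof.
have := @cvg_expr R 2^-1.
rewrite ger0_norm// => /(_ _) H.
rewrite (_ : mesh R = (fun N => 2^-1 ^+ N)); last by apply/funext => N; rewrite exprVn.
by apply: H; rewrite invf_lt1// ltr1n.
Qed.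

Lemma cvg_expR_mesh (R : realType) (c : R) : expR (mesh R N * c) @[N --> \oo] --> (1 : R).
Proof.
rewrite -[X in _ --> X]expR0.
apply: (continuous_cvg (h:=expR) _ (@continuous_expR R 0)).
by rewrite -[X in _ --> X](mul0r c); apply: cvgMl; exact: cvg_mesh.
Qed.

Lemma cvg_expR_pow2 (R : realType) (c : R) : 0 < c ->
  expR (- (2 ^+ N * c)) @[N --> \oo] --> (0 : R).
Proof.
move=> c0; apply: (@squeeze_cvgr _ _ _ _ (fun=> 0) (fun N => mesh R N * c^-1)).
- apply: nearW => N; rewrite expR_ge0/= expRN /mesh -invfM.
  rewrite lef_pV2 ?posrE ?expR_gt0 ?mulr_gt0 ?exprn_gt0//.
  by have := @expR_ge1Dx R (2 ^+ N * c); lra.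
- exact: cvg_cst.
- by rewrite -[X in _ --> X](mul0r c^-1); apply: cvgMl; exact: cvg_mesh.
Qed.

(* [v n] and [V j n] play the role of the integrals of [n^-s / zeta(s)] over
   [s >= 1] and [s >= 1 + 2^-j].  They are limits of Riemann sums along an
   ultrafilter, which preserves every inequality that is needed and avoids
   proving that the sums converge. *)
Lemma kernel_weights (R : realType) :
  exists (v : nat -> R) (V : nat -> nat -> R),
  [/\ forall n, (1 < n)%N ->
        n%:R^-1 * (ln n%:R ^- 2 - 2 / ln n%:R ^+ 3) <= v n <= 4 / (n%:R * ln n%:R ^+ 2),
      forall j n, (1 < n)%N -> 0 <= V j n <= v n,
      forall n Q, (1 < n)%N ->
        \sum_(1 <= q < Q.+1) mangoldt R q * v (n * q)%N <= ln n%:R * v n,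
      forall Q, \sum_(1 <= q < Q.+1) mangoldt R q * v q <= 1 &
      forall j n Q, (1 < n)%N ->
        \sum_(1 <= q < Q.+1) mangoldt R q * V j (n * q)%N <=
        ln n%:R * V j n - expR (- ((1 + mesh R j) * ln n%:R)) * (mesh R j / (1 + mesh R j))].
Proof.
have [U [UU oU]] := ultraFilterLemma (@eventually_filter).
have cU (u : nat -> R) (l : R) : u @ \oo --> l -> u @ U --> l.
  by move=> H; apply: cvg_trans H; exact: cvg_app.
have ucvg (I : nat -> nat) n : (1 < n)%N -> cvg (rsum R N (I N) n @[N --> U]).
  move=> n1; apply: (@ultra_bounded_cvg _ _ _ _ (4 / (n%:R * ln n%:R ^+ 2))) => N.
  by rewrite rsum_ge0/= (le_trans (rsum_mono R N (I N) n))// rsum_le.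
have rsum1 (I : nat -> nat) n : (1 < n)%N ->
    rsum R N (I N) n @[N --> U] --> lim (rsum R N (I N) n @[N --> U]).
  by move=> n1; exact: ucvg.
have cE (c : R) : expR (mesh R N * c) @[N --> U] --> (1 : R) by apply: cU; exact: cvg_expR_mesh.
have cS (I : nat -> nat) n Q : (0 < n)%N ->
   (\sum_(1 <= q < Q.+1) mangoldt R q * expR (- (mesh R N * ln q%:R)) * rsum R N (I N) (n * q))
     @[N --> U] --> \sum_(1 <= q < Q.+1) mangoldt R q * lim (rsum R N (I N) (n * q) @[N --> U]).
  move=> n0; elim: Q => [|Q IH].
    under eq_fun do rewrite big_geq//.
    by rewrite big_geq//; exact: cvg_cst.
  rewrite big_nat_recr//=; under eq_fun do rewrite big_nat_recr//=.
  apply: cvgD; first exact: IH.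
  move: Q.+1 (ltn0Sn Q) => q q0.
  (* When n = q = 1, convergence at n q = 1 is not at hand; the factor Lambda(1) = 0 removes the
     term. *)
  have [->|q1] := eqVneq q 1%N.
    rewrite mangoldt1 mul0r.
    under eq_fun do rewrite !mul0r.
    exact: cvg_cst.
  rewrite -[mangoldt R q in X in _ --> X]mulr1; apply: cvgM; last first.
    by apply: rsum1; nia.
  apply: cvgMr; under eq_fun do rewrite -mulrN; exact: cE.
have key (I : nat -> nat) n Q (tau : R) : (1 < n)%N ->
   (\forall N \near U, (I N <= 4 ^ N)%N /\ (I N)%:R * mesh R N = tau) ->
    \sum_(1 <= q < Q.+1) mangoldt R q * lim (rsum R N (I N) (n * q) @[N --> U]) <=
    ln n%:R * lim (rsum R N (I N) n @[N --> U]) - expR (- ((1 + tau) * ln n%:R)) * inv_zeta tau.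
  move=> n1 HI; have n0 : (0 < n)%N by lia.
  have L0 : 0 < ln (n%:R : R) by rewrite ln_gt0// ltr1n.
  have cR : expR (mesh R N * ln n%:R) * (ln n%:R * rsum R N (I N) n
      - expR (- ((1 + tau) * ln n%:R)) * inv_zeta tau
      + expR (- (2 ^+ N * ln n%:R))) @[N --> U] -->
      1 * (ln n%:R * lim (rsum R N (I N) n @[N --> U])
       - expR (- ((1 + tau) * ln n%:R)) * inv_zeta tau + 0).
    apply: cvgM; first exact: cE.
    apply: cvgD; last by apply: cU; exact: cvg_expR_pow2.
    by apply: cvgB; [apply: cvgMr; exact: rsum1|exact: cvg_cst].
  rewrite mul1r addr0 in cR.
  apply: (ler_cvg_to (cS I n Q n0) cR).
  by apply: filterS HI => N [h1 <-]; exact: rsum_mangoldt.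
exists (fun n => lim (rsum R N 0 n @[N --> U])).
(* For N >= j the starting index 2^(N-j) corresponds to s = 1 + 2^-j exactly, whatever N. *)
exists (fun j n => lim (rsum R N (2 ^ (N - j))%N n @[N --> U])).
split.
- move=> n n1; apply/andP; split; last first.
    apply: (ler_cvg_to (rsum1 (fun=> 0%N) n n1) (cvg_cst _)).
    by apply: nearW => N; exact: rsum_le.
  apply: (ler_cvg_to _ (rsum1 (fun=> 0%N) n n1)); last first.
    by apply: nearW => N; exact: rsum_ge.
  apply: cvgMr; apply: cvgB.
    rewrite -[X in _ --> X]mul1r; apply: cvgMl.
    rewrite -[X in _ --> X]subr0; apply: cvgB.
      by under eq_fun do rewrite -mulrN; exact: cE.
    by rewrite -[X in _ --> X](mul0r (27 / ln n%:R ^+ 3)); apply: cvgMl; apply: cU; exact: cvg_mesh.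
  apply: cvgMl; rewrite -[X in _ --> X]mulr1; apply: cvgMr.
  have c1 : 1 + mesh R N * ln n%:R @[N --> U] --> (1 : R).
    rewrite -[X in _ --> X]addr0; apply: cvgD; first exact: cvg_cst.
    by rewrite -[X in _ --> X](mul0r (ln n%:R)); apply: cvgMl; apply: cU; exact: cvg_mesh.
  by rewrite -[X in _ --> X](expr1n _ 3); exact: (cvgM c1 (cvgM c1 c1)).
- move=> j n n1; have H := rsum1 (fun N => 2 ^ (N - j))%N n n1; apply/andP; split.
    by apply: (ler_cvg_to (cvg_cst 0) H); apply: nearW => N; exact: rsum_ge0.
  by apply: (ler_cvg_to H (rsum1 (fun=> 0%N) n n1)); apply: nearW => N; exact: rsum_mono.
- move=> n Q n1; have := key (fun=> 0%N) n Q 0 n1.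
  rewrite [inv_zeta 0]/inv_zeta lexx mulr0 subr0; apply.
  by apply: nearW => N; rewrite mul0r.
- move=> Q.
  have := cS (fun=> 0%N) 1%N Q isT.
  under [X in _ --> X -> _]eq_bigr do rewrite mul1n.
  move=> H; apply: (ler_cvg_to H (cvg_cst (1 : R))).
  apply: nearW => N; apply: (le_trans (@rsum_mangoldt R N 0 1 Q isT (leq0n _))).
  rewrite ln1 !mulr0 oppr0 !mul0r expR0 [inv_zeta 0]/inv_zeta lexx.
  by rewrite mulr0 subr0 add0r mul1r.
- move=> j n Q n1.
  have m0 := mesh_gt0 R j.
  have := key (fun N => 2 ^ (N - j))%N n Q (mesh R j) n1.
  move=> /(_ _)/le_trans; apply.
    apply: oU; exists j => // N /= jN; split.
      apply: (@leq_trans (2 ^ N)); first by rewrite leq_exp2l// leq_subr.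
      by rewrite (_ : 4 = 2 * 2)%N// expnMn leq_pmulr// expn_gt0.
    rewrite natrX /mesh -(subnK jN) addnK exprD invfM mulrA divff ?mul1r//.
  by rewrite lerD2l lerN2 ler_wpM2l ?expR_ge0// inv_zeta_ge.
Qed.

(** * Substochastic divisibility walks *)


(* Recursion on the measure [mu]; junk unless [F f m] depends on [f] only below
   [mu m], see [wfrecE]. *)
Definition wfrec (R : realType) (mu : nat -> nat) (F : (nat -> R) -> nat -> R) (m : nat) : R :=
  iter (mu m).+1 F (fun=> 0) m.

Lemma wfrecE (R : realType) mu (F : (nat -> R) -> nat -> R) :
  (forall f g m, (forall k, (mu k < mu m)%N -> f k = g k) -> F f m = F g m) ->
  forall m, wfrec mu F m = F (wfrec mu F) m.
Proof.
move=> HF.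
have it j k m : (mu m < j)%N -> (mu m < k)%N -> iter j F (fun=> 0) m = iter k F (fun=> 0) m.
  elim: j k m => // j IH [//|k] m mj mk.
  by apply: HF => i im; apply: IH; lia.
by move=> m; rewrite {1}/wfrec /=; apply: HF => k km; apply: it.
Qed.

(** The defect of a row sum from 1 is the probability that the walk stops. *)
Definition div_kernel (R : realType) (p : nat -> nat -> R) :=
  [/\ forall m k, 0 <= p m k,
      forall m k, ~~ ((m < k)%N && (m %| k)%N) -> p m k = 0 &
      forall m N, (0 < m)%N -> \sum_(1 <= k < N.+1) p m k <= 1].

(* Expected number of visits to [A] in [(m, N]] of the walk started at [m]. *)
Definition hits (R : realType) (p : nat -> nat -> R) (A : set nat) (N : nat) : nat -> R :=
  wfrec (fun m => N - m)%N
    (fun f m => \sum_(m.+1 <= k < N.+1) p m k * ((k \in A)%:R + f k)).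

Lemma hitsE (R : realType) (p : nat -> nat -> R) A N m : div_kernel p ->
  hits p A N m = \sum_(1 <= k < N.+1) p m k * ((k \in A)%:R + hits p A N k).
Proof.
move=> [_ p0 _]; rewrite {1}/hits wfrecE; last first.
  move=> f g {}m H; apply: eq_big_nat => k /andP[mk kN]; rewrite H//; lia.
rewrite -/(hits p A N); have [mN|Nm] := ltnP m N.
  rewrite [RHS](big_cat_nat (n:=m.+1))//=; last by lia.
  rewrite [X in X + _]big1_seq ?add0r// => k; rewrite mem_index_iota => /andP[_ /andP[_ km]].
  by rewrite p0 ?mul0r// negb_and -leqNgt -ltnS km.
rewrite big_geq// big1_seq// => k; rewrite mem_index_iota => /andP[_ /andP[_ km]].
by rewrite p0 ?mul0r// negb_and -leqNgt; apply/orP; left; lia.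
Qed.

Lemma hits_ge0 (R : realType) (p : nat -> nat -> R) A N m : div_kernel p -> 0 <= hits p A N m.
Proof.
move=> kp; have [j] := ubnP (N - m)%N; elim: j m => // j IH m mj.
rewrite hitsE//; case: kp => [pge p0 _].
rewrite big_nat sumr_ge0// => k /andP[k0 kN].
have [mk|mk] := ltnP m k; last by rewrite p0 ?mul0r// negb_and -leqNgt mk.
by rewrite mulr_ge0// addr_ge0// ?ler0n// IH//; lia.
Qed.

(* Optional stopping on leaving [t]: [r k] is the probability that the walk
   started at [n0] reaches [k] without leaving [t] before. *)
Lemma kernel_duality (R : realType) (p : nat -> nat -> R) (r : nat -> R)
    (t : pred nat) n0 N (f : nat -> R) :
  (0 < n0 <= N)%N ->
  (forall k, (0 < k <= N)%N ->
    r k = (k == n0)%:R + \sum_(1 <= m < N.+1) (t m)%:R * r m * p m k) ->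
  \sum_(1 <= m < N.+1) (t m)%:R * r m * (f m - \sum_(1 <= k < N.+1) p m k * f k) =
  f n0 - \sum_(1 <= m < N.+1) (~~ t m)%:R * r m * f m.
Proof.
move=> n0N rE.
under eq_bigr do rewrite mulrBr mulr_sumr.
rewrite sumrB exchange_big/=.
have -> : \sum_(1 <= k < N.+1) \sum_(1 <= m < N.+1) (t m)%:R * r m * (p m k * f k) =
   \sum_(1 <= k < N.+1) (r k * f k - (k == n0)%:R * f k).
  apply: eq_big_nat => k kN; rewrite [in RHS]rE//.
  rewrite mulrDl addrC addKr mulr_suml; apply: eq_bigr => m _; ring.
rewrite sumrB.
have -> : \sum_(1 <= k < N.+1) (k == n0)%:R * f k = f n0.
  rewrite (bigD1_seq n0)/= ?iota_uniq ?mem_index_iota// eqxx mul1r big1 ?addr0//.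
  by move=> k /negbTE ->; rewrite mul0r.
rewrite opprB addrCA; congr (_ + _); rewrite -sumrB -sumrN; apply: eq_bigr => m _.
by case: (t m) => /=; ring.
Qed.

Lemma ln_ln_large (R : realType) (B : R) :
  exists X : nat, forall N : nat, (X <= N)%N -> B <= ln (ln (N%:R : R)).
Proof.
exists (Num.truncn (expR (expR B))).+1 => N XN.
have h : expR (expR B) <= N%:R.
  by apply: (le_trans (ltW (truncnS_gt _))); rewrite ler_nat.
have hN : 0 < (N%:R : R) by apply: lt_le_trans h; exact: expR_gt0.
have h2 : expR B <= ln (N%:R : R) by rewrite -[leLHS]expRK ler_ln// posrE expR_gt0.
rewrite -[leLHS]expRK ler_ln// posrE ?expR_gt0//.
by apply: lt_le_trans h2; exact: expR_gt0.
Qed.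

(** * Chains in [A] whose last entry divides a vertex, and good vertices *)

Definition dvd_lt (a b : nat) := (a < b)%N && (a %| b)%N.

(** The starting vertex is an anchor: it need not lie in [A] and is not counted, so chains can be
    glued at vertices outside [A]. *)
Definition div_chain (A : set nat) (n0 : nat) (l : seq nat) :=
  path dvd_lt n0 l && all (fun a => a \in A) l.

(** For m > 0 the cap k <= m loses nothing, because a chain grows strictly and its last entry
    divides m. With no chain at all the maximum is 0. *)
Definition longest_chain (A : set nat) (n0 m : nat) : nat :=
  \max_(k < m.+1 | `[< exists l, [/\ size l = k, div_chain A n0 l & (last n0 l %| m)%N] >]) k.

Lemma path_size_last n0 l : path dvd_lt n0 l -> (n0 + size l <= last n0 l)%N.
Proof. by elim: l n0 => /= [n0|a l IH n0 /andP[/andP[h _] /IH]]; lia. Qed.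

Lemma longest_chain_le A n0 m : (longest_chain A n0 m <= m)%N.
Proof. by apply/bigmax_leqP => k _; rewrite -ltnS. Qed.

Lemma longest_chain_ub (R : realType) A n0 m (B : R) : 0 <= B ->
  (forall l, div_chain A n0 l -> (last n0 l %| m)%N -> (size l)%:R <= B) ->
  (longest_chain A n0 m)%:R <= B.
Proof.
move=> B0 H; rewrite /longest_chain; elim/big_ind: _ => //.
- by move=> x y hx hy; rewrite /maxn; case: ifP.
- by move=> k /asboolP[l [<- h1 h2]]; exact: H.
Qed.

(** If k lies in [A], it can be appended to a longest chain for m; otherwise that chain still serves
    for k. Hence visits along a path are bounded by the growth of [longest_chain]. *)
Lemma longest_chain_step A n0 m k : (0 < n0)%N -> (0 < m)%N -> (n0 %| m)%N -> dvd_lt m k ->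
  (longest_chain A n0 m + (k \in A) <= longest_chain A n0 k)%N.
Proof.
move=> n00 m0 n0m mk.
have lb l : div_chain A n0 l -> (last n0 l %| k)%N -> (size l <= longest_chain A n0 k)%N.
  move=> hl lk.
  have sk : (size l < k.+1)%N.
    have := path_size_last (proj1 (andP hl)).
    by case/andP: mk => mk _; have := dvdn_leq (ltn_trans m0 mk) lk; lia.
  have := @leq_bigmax_cond _
    (fun k' : 'I_k.+1 => `[< exists l, [/\ size l = k', div_chain A n0 l & (last n0 l %| k)%N] >])
    (fun k' => k' : nat) (Ordinal sk).
  by apply; apply/asboolP; exists l.
suff H l : div_chain A n0 l -> (last n0 l %| m)%N ->
    (size l + (k \in A) <= longest_chain A n0 k)%N.
  rewrite {1}/longest_chain; elim/big_ind: _ => //.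
  - by apply: (H [::]).
  - by move=> x y hx hy; rewrite /maxn; case: ifP.
  - by move=> j /asboolP[l [<- h1 h2]]; exact: H.
move=> hl lm; have lk := dvdn_trans lm (proj2 (andP mk)).
case: (boolP (k \in A)) => kA; last by rewrite addn0; exact: lb.
have -> : (size l + true)%N = size (rcons l k) by rewrite size_rcons addn1.
apply: lb; last by rewrite last_rcons.
move: hl; rewrite /div_chain rcons_path all_rcons kA => /andP[-> ->]/=.
rewrite andbT; apply/andP; split=> //.
by apply: leq_ltn_trans (dvdn_leq m0 lm) _; case/andP: mk.
Qed.

Definition good (R : realType) (p : nat -> nat -> R) A (D : R) (m : nat) :=
  forall e X, 0 < e ->
    exists2 N : nat, (X <= N)%N & (D - e) * ln (ln N%:R) <= hits p A N m.

(** * First exit of the walk from a set of vertices *)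

Section first_exit.
Variables (R : realType) (p : nat -> nat -> R) (t : pred nat) (n0 : nat).
Hypothesis kp : div_kernel p.

Definition reach : nat -> R := wfrec id
  (fun f k => (k == n0)%:R + \sum_(1 <= m < k) (t m)%:R * f m * p m k).

Lemma reachE k N : (0 < k <= N)%N ->
  reach k = (k == n0)%:R + \sum_(1 <= m < N.+1) (t m)%:R * reach m * p m k.
Proof.
move=> /andP[k0 kN]; rewrite {1}/reach wfrecE; last first.
  by move=> f g m H; congr (_ + _); apply: eq_big_nat => i /andP[_ im]; rewrite H.
rewrite -/reach; congr (_ + _); rewrite [RHS](big_cat_nat (n:=k))//=; last by lia.
rewrite [X in _ + X]big1_seq ?addr0// => m; rewrite mem_index_iota => /andP[_ /andP[km _]].
by case: kp => _ p0 _; rewrite p0 ?mulr0// negb_and -leqNgt km.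
Qed.

Lemma reach_ge0 k : (0 < k)%N -> 0 <= reach k.
Proof.
have [j] := ubnP k; elim: j k => // j IH k kj k0.
rewrite (@reachE k k) ?k0//= addr_ge0// big_nat sumr_ge0// => m /andP[m0 mk].
have [km|mk'] := leqP k m.
  by case: kp => _ p0 _; rewrite p0 ?mulr0// negb_and -leqNgt km.
by rewrite !mulr_ge0// ?IH//; [lia|case: kp].
Qed.

Lemma reach_eq0 k : (0 < k)%N -> ~~ (n0 %| k)%N -> reach k = 0.
Proof.
have [j] := ubnP k; elim: j k => // j IH k kj k0 nk.
rewrite (@reachE k k) ?k0//= big1_seq ?addr0.
  by case: eqP nk => // ->; rewrite dvdnn.
move=> m; rewrite mem_index_iota => /andP[_ /andP[m0 mk]].
have [dmk|dmk] := boolP ((m < k)%N && (m %| k)%N); last first.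
  by case: kp => _ p0 _; rewrite p0 ?mulr0.
case/andP: dmk => mk' dmk.
rewrite IH ?mulr0 ?mul0r//; first lia.
by apply: contra nk => h; exact: dvdn_trans dmk.
Qed.

(** Duality with f = 1: for N >= n0 the exit probability is 1 minus the mass lost inside t by
    stopping or by jumping past N. *)
Lemma exit_le1 N : (0 < n0)%N -> \sum_(1 <= m < N.+1) (~~ t m)%:R * reach m <= 1.
Proof.
move=> n00; suff H N' : (n0 <= N')%N -> \sum_(1 <= m < N'.+1) (~~ t m)%:R * reach m <= 1.
  have [/H//|Nn0] := leqP n0 N.
  apply: le_trans (H n0 (leqnn _)); rewrite [leRHS](big_cat_nat (n:=N.+1))//=; last by lia.
  rewrite lerDl big_nat sumr_ge0// => m /andP[m0 _].
  by rewrite mulr_ge0// reach_ge0//; lia.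
move=> n0N.
have := @kernel_duality _ p reach t n0 N' (fun=> 1).
rewrite n00 n0N => /(_ isT (fun k => @reachE k N')).
under [X in _ = _ - X]eq_bigr do rewrite mulr1.
move=> H; rewrite -subr_ge0 -H big_nat sumr_ge0// => m /andP[m0 _].
rewrite mulr_ge0 ?mulr_ge0 ?reach_ge0//.
rewrite subr_ge0; under eq_bigr do rewrite mulr1.
by case: kp => _ _; apply.
Qed.

End first_exit.

(** Past a partial sum within [eta] of the supremum, the rest is at most [eta]. The lower bound [M0]
    on M serves to place a chosen vertex in the head. *)
Lemma bounded_tail (R : realType) (rho : nat -> R) (eta : R) M0 :
  (forall m, (0 < m)%N -> 0 <= rho m) ->
  (forall N, \sum_(1 <= m < N.+1) rho m <= 1) -> 0 < eta ->
  exists2 M, (M0 <= M)%N &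
    forall N, (M <= N)%N -> \sum_(M.+1 <= m < N.+1) rho m <= eta.
Proof.
move=> rho0 rho1 eta0; pose S N := \sum_(1 <= m < N.+1) rho m.
have Smono M N : (M <= N)%N -> S N = S M + \sum_(M.+1 <= m < N.+1) rho m.
  by move=> MN; rewrite /S [LHS](big_cat_nat (n:=M.+1)).
have hs : has_sup (range S).
  by split; [exists (S 0%N), 0%N|exists 1 => _ [N _ <-]; exact: rho1].
have [_ [M1 _ <-] hM1] := sup_adherent eta0 hs.
exists (maxn M0 M1) => [|N MN]; first by rewrite leq_maxl.
have : S N <= sup (range S) by apply: ub_le_sup; [case: hs|exists N].
have M1M : (M1 <= maxn M0 M1)%N by rewrite leq_maxr.
rewrite (Smono _ _ MN) (Smono _ _ M1M).
have : 0 <= \sum_(M1.+1 <= m < (maxn M0 M1).+1) rho m.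
  by rewrite big_nat sumr_ge0// => m /andP[m0 _]; apply: rho0; lia.
lra.
Qed.

(** If the conclusion fails, chains below good vertices are short. Optional stopping at the first
    bad vertex, applied to truncated chain length plus expected future visits, then contradicts
    goodness of [n0]: bad exits up to M lose a fixed amount, and later ones have small total
    probability. *)
Lemma good_extend (R : realType) (p : nat -> nat -> R) A (D C : R) (N0 n0 : nat) :
  div_kernel p -> 0 < C ->
  (forall N m, (N0 <= N)%N -> (0 < m)%N -> hits p A N m <= C * ln (ln N%:R)) ->
  (0 < n0)%N -> good p A D n0 ->
  forall (e : R) (Y : nat), 0 < e < D ->
  exists m l y, [/\ (0 < m)%N, good p A D m, div_chain A n0 l, (last n0 l %| m)%N &
     (m <= y)%N /\ (Y <= y)%N /\ (D - e) * ln (ln y%:R) <= (size l)%:R].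
Proof.
move=> kp C0 hC n00 gn0 e Y /andP[e0 eD]; apply: contrapT => Hno.
pose LL (N : nat) : R := ln (ln N%:R).
have Hc m l y : (0 < m)%N -> good p A D m -> div_chain A n0 l -> (last n0 l %| m)%N ->
    (m <= y)%N -> (Y <= y)%N -> (size l)%:R <= (D - e) * LL y.
  move=> m0 gm hl lm my Yy; rewrite leNgt; apply/negP => h; apply: Hno.
  by exists m, l, y; split => //; split => //; split => //; exact: ltW.
pose t : pred nat := fun m => `[< good p A D m >].
have [X0 LL0] := ln_ln_large (0 : R).
pose rho m : R := (~~ t m)%:R * reach p t n0 m.
have rho0 m : (0 < m)%N -> 0 <= rho m by move=> m0; rewrite mulr_ge0// reach_ge0.
have rho1 N : \sum_(1 <= m < N.+1) rho m <= 1 by exact: exit_le1.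
(* [em m] is the margin by which a bad m falls short of D; at good vertices the value 1 is a
   placeholder. *)
have /choice[em em0] : forall m, exists em : R, 0 < em /\
   (~ good p A D m -> exists X, forall N, (X <= N)%N -> hits p A N m <= (D - em) * LL N).
  move=> m; have [gm|] := pselect (good p A D m); first by exists 1; split.
  move=> /existsNP[e1] /existsNP[X1] /not_implyP[e10 h].
  exists e1; split => // _; exists X1 => N XN; rewrite leNgt; apply/negP => h1.
  by apply: h; exists N => //; exact: ltW.
have /choice[Xm hXm] : forall m, exists X, ~ good p A D m ->
    forall N, (X <= N)%N -> hits p A N m <= (D - em m) * LL N.
  move=> m; have [gm|ngm] := pselect (good p A D m); first by exists 0%N.
  by have [X hX] := (em0 m).2 ngm; exists X.
(* Either no path ever leaves the good vertices, or some exit has positive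
   probability and costs a definite amount; both give a gain [G]. *)
have [M [eta [G [G0 htail hG]]]] : exists M (eta G : R), [/\ 0 < G,
    forall N, (M <= N)%N -> \sum_(M.+1 <= m < N.+1) rho m <= eta &
    G <= e * (1 - \sum_(1 <= m < M.+1) rho m) + \sum_(1 <= m < M.+1) rho m * em m - C * eta].
  have [h|/existsNP[m1 /not_implyP[m10 hm1]]] := pselect (forall m, (0 < m)%N -> rho m = 0).
    exists 0%N, 0, e; split => //.
      by move=> N _; rewrite big_nat big1// => m /andP[m0 _]; exact: h.
    by rewrite !big_geq//; lra.
  have rm1 : 0 < rho m1 by rewrite lt_neqAle rho0// andbT eq_sym; apply/eqP.
  have d0 : 0 < rho m1 * em m1 by rewrite mulr_gt0//; case: (em0 m1).
  (* This [eta] makes the tail cost C eta equal to half of the gain [rho m1 * em m1]. *)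
  have eta0 : 0 < rho m1 * em m1 / (2 * C) by rewrite divr_gt0// mulr_gt0.
  have [M m1M hM] := bounded_tail m1 rho0 rho1 eta0.
  exists M, (rho m1 * em m1 / (2 * C)), (rho m1 * em m1 / 2); split => //.
    by rewrite divr_gt0.
  have -> : C * (rho m1 * em m1 / (2 * C)) = rho m1 * em m1 / 2.
    by field; rewrite gt_eqF.
  have : rho m1 * em m1 <= \sum_(1 <= m < M.+1) rho m * em m.
    rewrite (bigD1_seq m1)/= ?iota_uniq ?mem_index_iota ?m10//.
    rewrite lerDl big_seq_cond sumr_ge0// => m /andP[+ _].
    rewrite mem_index_iota => /andP[m0 _].
    by rewrite mulr_ge0 ?rho0// ltW//; case: (em0 m).
  have : 0 <= e * (1 - \sum_(1 <= m < M.+1) rho m).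
    by rewrite mulr_ge0 ?(ltW e0)// subr_ge0.
  lra.
(* Beyond [X1], half of G ln ln N exceeds the constant M + 1 that is left over at the end. *)
have [X1 hX1] := ln_ln_large (2 * (M%:R + 2) / G).
pose X := (maxn X0 (maxn X1 (maxn N0 (maxn Y (maxn n0 (maxn M
   (\max_(m < M.+1) Xm m)))))))%N.
have G2 : 0 < G / 2 by rewrite divr_gt0.
have [N XN hN] := gn0 (G / 2) X G2.
move: XN; rewrite /X !geq_max => /and5P[X0N X1N N0N YN /and3P[n0N MN /bigmax_leqP XmN]].
have L0 := LL0 _ X0N; have L1 := hX1 _ X1N.
rewrite -/(LL N) in L0 L1 hN.
(* [Y'] exceeds the chain length at good vertices up to N by at least 1, so truncation does not
   spoil a step from them, while it caps the contribution of far exits. The shift by [Y'] in [Psi]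
   gives the right sign when the walk stops. *)
set Y' := (D - e) * LL N + 1.
have Y'1 : 1 <= Y' by rewrite lerDr mulr_ge0// subr_ge0 ltW.
pose cst m : R := Num.min (longest_chain A n0 m)%:R Y'.
pose Psi m := cst m - Y' + hits p A N m.
have cgood m : (0 < m <= N)%N -> good p A D m -> (longest_chain A n0 m)%:R <= Y' - 1.
  move=> /andP[m0 mN] gm; apply: longest_chain_ub; first lra.
  by move=> l hl lm; rewrite /Y' addrK; apply: (Hc m).
have dual := @kernel_duality _ p (reach p t n0) t n0 N Psi _ (fun k => @reachE _ p t n0 kp k N).
rewrite n00 n0N in dual; move: (dual isT) => {}dual.
(* [Psi] is subharmonic at good multiples of [n0]: a visit spent from [hits] is regained in chain
   length. *)
have sub m : (0 < m <= N)%N -> (t m)%:R * reach p t n0 m *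
    (Psi m - \sum_(1 <= k < N.+1) p m k * Psi k) <= 0.
  move=> mN; have m0 := proj1 (andP mN).
  have [tm|] := boolP (t m); last by rewrite !mul0r.
  have [n0m|n0m] := boolP (n0 %| m)%N; last by rewrite (reach_eq0 _ kp)// mulr0 mul0r.
  have gm : good p A D m by apply/asboolP.
  have cm := cgood m mN gm.
  apply: mulr_ge0_le0; first by rewrite mulr_ge0// reach_ge0.
  have -> : \sum_(1 <= k < N.+1) p m k * Psi k =
     \sum_(1 <= k < N.+1) p m k * (cst k - (k \in A)%:R)
     - Y' * \sum_(1 <= k < N.+1) p m k + hits p A N m.
    rewrite [X in _ + X](hitsE _ _ _ kp) mulr_sumr -sumrB -big_split/=.
    by apply: eq_bigr => k _; rewrite /Psi; ring.
  set c := (longest_chain A n0 m)%:R : R in cm.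
  have cE : cst m = c by rewrite /cst min_l//; lra.
  have h1 : c * \sum_(1 <= k < N.+1) p m k <=
     \sum_(1 <= k < N.+1) p m k * (cst k - (k \in A)%:R).
    rewrite mulr_sumr ler_sum// => k _; rewrite mulrC.
    have [mk|nmk] := boolP (dvd_lt m k); last first.
      by case: kp => _ p0 _; rewrite p0// !mul0r.
    rewrite ler_wpM2l//; first by case: kp.
    rewrite lerBrDr /cst le_min; apply/andP; split.
      by rewrite -natrD ler_nat; exact: longest_chain_step.
    have kA1 : (k \in A)%:R <= 1 :> R by case: (k \in A).
    by lra.
  have h2 : \sum_(1 <= k < N.+1) p m k <= 1 by case: kp => _ _; apply.
  rewrite /Psi cE; move: h1 h2; set s := \sum_(1 <= k < N.+1) p m k.
  set s' := \sum_(1 <= k < N.+1) p m k * _ => h1 h2.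
  have : 0 <= (1 - s) * (Y' - c) by rewrite mulr_ge0//; lra.
  by lra.
have Psi0 : Psi n0 <= \sum_(1 <= m < N.+1) rho m * Psi m.
  rewrite -subr_le0 -dual big_nat; apply: sumr_le0 => m hm; exact: sub.
have Psin0 : hits p A N n0 - Y' <= Psi n0.
  have : 0 <= cst n0 by rewrite /cst le_min ler0n; lra.
  by rewrite /Psi; lra.
have head : \sum_(1 <= m < M.+1) rho m * Psi m <=
    \sum_(1 <= m < M.+1) (rho m * (M%:R - Y' + D * LL N) - rho m * em m * LL N).
  apply: ler_sum_nat => m /andP[m0 mM].
  have [tm|ntm] := boolP (t m); first by rewrite /rho tm !mul0r subr0.
  rewrite -mulrA -mulrBr ler_wpM2l ?rho0//.
  have ngm : ~ good p A D m by move/asboolP: ntm.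
  have := hXm m ngm N (XmN (Ordinal mM) isT).
  have : cst m <= M%:R.
    rewrite /cst ge_min; apply/orP; left; rewrite ler_nat.
    by apply: leq_trans (longest_chain_le _ _ _) _; rewrite -ltnS.
  by rewrite /Psi; lra.
have tail : \sum_(M.+1 <= m < N.+1) rho m * Psi m <= eta * (C * LL N).
  apply: (@le_trans _ _ (\sum_(M.+1 <= m < N.+1) rho m * (C * LL N))).
    apply: ler_sum_nat => m /andP[Mm _].
    have m0 : (0 < m)%N by exact: leq_ltn_trans (leq0n _) Mm.
    rewrite ler_wpM2l ?rho0//.
    have : hits p A N m <= C * LL N by exact: hC.
    have : cst m <= Y' by rewrite /cst ge_min lexx orbT.
    by rewrite /Psi; lra.
  by rewrite -mulr_suml ler_wpM2r ?htail// mulr_ge0// ltW.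
move: Psi0; rewrite [leRHS](big_cat_nat (n:=M.+1))//= => Psi0.
move: head; rewrite sumrB -!mulr_suml.
have := rho1 M; have : 0 <= \sum_(1 <= m < M.+1) rho m.
  by rewrite big_nat sumr_ge0// => m /andP[m0 _]; exact: rho0.
move: hG tail Psi0.
set S := \sum_(1 <= m < M.+1) rho m; set E := \sum_(1 <= m < M.+1) rho m * em m.
set S1 := \sum_(1 <= m < M.+1) _; set S2 := \sum_(M.+1 <= m < N.+1) _.
move=> hG tail Psi0 S0 S_1 head.
have : hits p A N n0 <= Y' + S * (M%:R - Y' + D * LL N) - E * LL N + eta * (C * LL N) by lra.
have : G * LL N <= (e * (1 - S) + E - C * eta) * LL N by rewrite ler_wpM2r.
have : S * M%:R <= M%:R by rewrite -[leRHS]mul1r ler_wpM2r.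
have : 2 * (M%:R + 2) <= LL N * G by rewrite -ler_pdivrMr.
by rewrite /Y' in hN *; lra.
Qed.

(** * The von Mangoldt walk *)


(* Probability that the walk started at 1 visits [m]. *)
Definition flow (R : realType) (v : nat -> R) (m : nat) : R :=
  if m == 1%N then 1 else ln m%:R * v m.

Definition mangoldt_kernel (R : realType) (v : nat -> R) (m k : nat) : R :=
  if (m < k)%N && (m %| k)%N then mangoldt R (k %/ m) * v k / flow v m else 0.

(** Substitute k = mq; the diagonal q = 1, absent from the kernel, is harmless because Lambda(1) =
    0. *)
Lemma mangoldt_kernel_sum (R : realType) (v g : nat -> R) m N : (0 < m)%N ->
  \sum_(1 <= k < N.+1) mangoldt_kernel v m k * g k =
  (\sum_(1 <= q < (N %/ m).+1) mangoldt R q * (v (m * q)%N * g (m * q)%N)) / flow v m.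
Proof.
move=> m0; rewrite mulr_suml.
pose F k := mangoldt R (k %/ m) * (v k * g k) / flow v m.
transitivity (\sum_(1 <= k < N.+1 | (m %| k)%N) F k); last first.
  by rewrite sum_multiples//; apply: eq_big_nat => q _; rewrite /F mulKn.
rewrite /F; clear F.
rewrite [RHS]big_mkcond; apply: eq_big_nat => k /andP[k0 _].
rewrite /mangoldt_kernel; case: (boolP (m %| k)%N) => mk; last by rewrite andbF mul0r.
rewrite andbT; case: ltnP => h; first by ring.
have := dvdn_leq k0 mk => h'.
have -> : k = m by lia.
by rewrite divnn m0 mangoldt1 !mul0r.
Qed.

Lemma sum_cofactor (R : realType) (F : nat -> R) m k N : (0 < m)%N -> (0 < k <= N)%N ->
  \sum_(1 <= d < N.+1) (if (m * d)%N == k then F d else 0) =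
  if (m %| k)%N then F (k %/ m)%N else 0.
Proof.
move=> m0 /andP[k0 kN]; case: ifPn => mk; last first.
  rewrite big1// => d _; case: eqP => // h.
  by move: mk; rewrite -h dvdn_mulr.
have q0 : (0 < k %/ m)%N by rewrite divn_gt0// dvdn_leq.
have qN : (k %/ m <= N)%N by apply: leq_trans (leq_div _ _) kN.
rewrite (bigD1_seq (k %/ m)%N)/= ?iota_uniq ?mem_index_iota ?q0//.
rewrite mulnC divnK// eqxx big1 ?addr0// => d dk.
by case: eqP => // h; move: dk; rewrite -h mulKn// eqxx.
Qed.

Lemma sum_mangoldt_cofactor (R : realType) k N : (0 < k <= N)%N ->
  \sum_(1 <= m < N.+1 | (m %| k)%N) mangoldt R (k %/ m) = ln (k%:R : R).
Proof.
move=> kN; rewrite -(sum_mangoldt R kN) [LHS]big_mkcond [RHS]big_mkcond/=.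
transitivity (\sum_(1 <= m < N.+1) \sum_(1 <= d < N.+1)
    (if (m * d)%N == k then mangoldt R d else 0)).
  by apply: eq_big_nat => m /andP[m0 _]; rewrite sum_cofactor.
rewrite exchange_big/=; apply: eq_big_nat => d /andP[d0 _].
under eq_bigr do rewrite mulnC.
by rewrite (sum_cofactor (fun=> mangoldt R d) d0 kN).
Qed.

(** Picks the index j of the [V j] that drops at m: 2^-j ln m lies between ln 2 and 2 ln 2. *)
Lemma trunc_log_bounds (R : realType) m : (1 < m)%N ->
  (2 ^ trunc_log 2 (trunc_log 2 m))%N%:R * ln 2 <= ln (m%:R : R)
  /\ ln (m%:R : R) <= (2 ^ trunc_log 2 (trunc_log 2 m))%N%:R * (2 * ln 2).
Proof.
move=> m1; have m0 : (0 < m)%N by lia.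
have l0 : 0 < ln (2 : R) by rewrite ln_gt0// ltr1n.
set T := trunc_log 2 m.
have T0 : (0 < T)%N by rewrite trunc_log_gt0.
have /andP[a1 a2] := trunc_log_bounds (isT : (1 < 2)%N) m0.
have /andP[b1 b2] := trunc_log_bounds (isT : (1 < 2)%N) T0.
have lnX j : ln ((2 ^ j)%N%:R : R) = j%:R * ln 2 by rewrite natrX lnXn// mulr_natl.
split.
  apply: (@le_trans _ _ (T%:R * ln 2)); first by rewrite ler_pM2r// ler_nat.
  by rewrite -lnX ler_ln ?posrE ?ltr0n ?expn_gt0// ler_nat.
apply: (@le_trans _ _ (T.+1%:R * ln 2)).
  by rewrite -lnX ler_ln ?posrE ?ltr0n ?expn_gt0// ler_nat ltnW.
by rewrite mulrA ler_pM2r// -natrM ler_nat; move: b2; rewrite expnS; lia.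
Qed.

Section kernel.
Variables (R : realType) (v : nat -> R) (V : nat -> nat -> R).
Hypothesis v_bounds : forall n, (1 < n)%N ->
  n%:R^-1 * (ln n%:R ^- 2 - 2 / ln n%:R ^+ 3) <= v n <= 4 / (n%:R * ln n%:R ^+ 2).
Hypothesis V_bounds : forall j n, (1 < n)%N -> 0 <= V j n <= v n.
Hypothesis v_super : forall n Q, (1 < n)%N ->
  \sum_(1 <= q < Q.+1) mangoldt R q * v (n * q)%N <= ln n%:R * v n.
Hypothesis v_super1 : forall Q, \sum_(1 <= q < Q.+1) mangoldt R q * v q <= 1.
Hypothesis V_super : forall j n Q, (1 < n)%N ->
  \sum_(1 <= q < Q.+1) mangoldt R q * V j (n * q)%N <=
  ln n%:R * V j n - expR (- ((1 + mesh R j) * ln n%:R)) * (mesh R j / (1 + mesh R j)).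

Let ln0 n : (1 < n)%N -> 0 < ln (n%:R : R).
Proof. by move=> n1; rewrite ln_gt0// ltr1n. Qed.

(** The lower bound on v is negative while ln n < 2, so positivity is drawn from the strict drop of
    [V 0], which lies below v. *)
Lemma weight_gt0 n : (1 < n)%N -> 0 < v n.
Proof.
move=> n1; have := V_super 0 0 n1; rewrite big_geq//.
have := mesh_gt0 R 0; set t := mesh R 0 => t0.
have : 0 < expR (- ((1 + t) * ln (n%:R : R))) * (t / (1 + t)).
  by rewrite mulr_gt0 ?expR_gt0// divr_gt0// addr_gt0.
have /andP[_ h] := V_bounds 0 n1 => h1 h2.
have : 0 < ln (n%:R : R) * V 0 n by lra.
by rewrite pmulr_rgt0 ?ln0// => h3; lra.
Qed.

Lemma flow_gt0 m : (0 < m)%N -> 0 < flow v m.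
Proof.
rewrite /flow => m0; case: eqP => // m1; have {}m1 : (1 < m)%N by lia.
by rewrite mulr_gt0 ?ln0 ?weight_gt0.
Qed.

Let p := mangoldt_kernel v.

Lemma mangoldt_div_kernel : div_kernel p.
Proof.
split.
- move=> m k; rewrite /p /mangoldt_kernel; case: ifP => // /andP[mk dmk].
  have [m0|m0] := posnP m; first by move: dmk mk; rewrite m0 dvd0n => /eqP ->.
  rewrite divr_ge0 ?mulr_ge0 ?mangoldt_ge0 ?(ltW (weight_gt0 _)) ?(ltW (flow_gt0 _))//.
  lia.
- by move=> m k /negbTE h; rewrite /p /mangoldt_kernel h.
- move=> m N m0.
  have := mangoldt_kernel_sum v (fun=> 1) N m0.
  under eq_bigr do rewrite mulr1.
  under [in X in _ = X -> _]eq_bigr do rewrite mulr1.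
  move=> ->; rewrite ler_pdivrMr ?flow_gt0// mul1r /flow.
  case: eqP => [->|m1]; last by apply: v_super; lia.
  by under eq_bigr do rewrite mul1n; exact: v_super1.
Qed.

(* A Lyapunov function bounding the number of steps below [N]: each [V j / v] is
   superharmonic, with a drop bounded below where [2^-j ln m] is of order 1. *)
Let kappa : R := 32 / ln 2.
Let Phi J m : R := kappa * ((\sum_(0 <= j < J.+1) V j m) / v m).

Let l2 : 0 < ln (2 : R). Proof. by rewrite ln_gt0// ltr1n. Qed.
Let kappa0 : 0 < kappa. Proof. by rewrite divr_gt0. Qed.

Lemma lyapunov_drop J m N : (1 < m)%N -> (trunc_log 2 (trunc_log 2 m) <= J)%N ->
  1 + \sum_(1 <= k < N.+1) p m k * Phi J k <= Phi J m.
Proof.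
move=> m1 jJ; have m0 : (0 < m)%N by lia.
have L0 := ln0 m1; have v0 := weight_gt0 m1.
rewrite (mangoldt_kernel_sum v (Phi J) N m0) /flow.
have -> : (m == 1%N) = false by apply/eqP; lia.
pose d j : R := expR (- ((1 + mesh R j) * ln m%:R)) * (mesh R j / (1 + mesh R j)).
have d0 j : 0 <= d j.
  have := mesh_gt0 R j => h; rewrite mulr_ge0 ?expR_ge0// divr_ge0 ?ltW// addr_gt0//.
have step : \sum_(1 <= q < (N %/ m).+1) mangoldt R q * (v (m * q)%N * Phi J (m * q)%N) <=
    kappa * \sum_(0 <= j < J.+1) (ln m%:R * V j m - d j).
  have -> : \sum_(1 <= q < (N %/ m).+1) mangoldt R q * (v (m * q)%N * Phi J (m * q)%N) =
     kappa * \sum_(0 <= j < J.+1) \sum_(1 <= q < (N %/ m).+1) mangoldt R q * V j (m * q)%N.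
    rewrite exchange_big/= mulr_sumr; apply: eq_big_nat => q /andP[q0 _].
    have vq : v (m * q)%N != 0 by rewrite gt_eqF// weight_gt0//; nia.
    by rewrite -mulr_sumr /Phi; field.
  by rewrite ler_pM2l//; apply: ler_sum => j _; exact: V_super.
(* The term at the scale of m suffices: [d j] >= t/(8m) with tL >= ln 2, whereas L v(m) <= 4/(mL);
   the ratio is at most 32/ln 2. *)
have drop : ln m%:R * v m <= kappa * \sum_(0 <= j < J.+1) d j.
  set j := trunc_log 2 (trunc_log 2 m) in jJ.
  have dj : d j <= \sum_(0 <= j < J.+1) d j.
    have jin : j \in index_iota 0 J.+1 by rewrite mem_index_iota.
    by rewrite (bigD1_seq j jin (iota_uniq _ _))/= lerDl sumr_ge0.
  apply: (@le_trans _ _ (kappa * d j)); last by rewrite ler_pM2l.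
  have [t1 t2] := trunc_log_bounds R m1.
  have /andP[_ vle] := v_bounds m1.
  rewrite -/j natrX in t1 t2.
  set t := mesh R j; set L := ln (m%:R : R) in L0 t1 t2 vle *.
  have t0 : 0 < t := mesh_gt0 R j.
  have tle1 : t <= 1 := mesh_le1 R j.
  have tE : t * 2 ^+ j = 1 by rewrite /t /mesh mulVf// expf_neq0.
  have h1 : ln 2 <= t * L by rewrite -(ler_pM2l t0) mulrA tE mul1r in t1.
  have h2 : t * L <= 2 * ln 2 by have := t2; rewrite -(ler_pM2l t0) [t * (_ * _)]mulrA tE mul1r.
  have mE : expR (- ((1 + t) * L)) = m%:R^-1 * expR (- (t * L)).
    by rewrite mulrDl mul1r opprD expRD [expR (- L)]expRN lnK// posrE ltr0n.
  have e4 : 4^-1 <= expR (- (t * L)).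
    have -> : 4^-1 = expR (- (2 * ln 2)) :> R.
      rewrite expRN; congr (_^-1); rewrite mulr_natl -lnXn// lnK ?posrE ?exprn_gt0//.
      by rewrite expr2; ring.
    by rewrite ler_expR lerN2.
  have mr0 : 0 < (m%:R : R)^-1 by rewrite invr_gt0 ltr0n.
  apply: (@le_trans _ _ (4 * m%:R^-1 / L)).
    rewrite mulrC ler_pdivlMr// -mulrA -expr2.
    by move: vle; rewrite ler_pdivlMr ?mulr_gt0 ?exprn_gt0 ?ltr0n//
      => vle; rewrite ler_pdivlMr ?ltr0n// mulrAC -mulrA.
  rewrite ler_pdivrMr// /d -/t -/L mE /kappa.
  have e0 := expR_gt0 (- (t * L)); set e := expR (- (t * L)) in e4 e0 *.
  have td : 2^-1 * t <= t / (1 + t) by rewrite ler_pdivlMr ?addr_gt0//; nra.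
  have -> : 32 / ln 2 * (m%:R^-1 * e * (t / (1 + t))) * L =
    m%:R^-1 * (32 / ln 2 * e * (t / (1 + t)) * L) by ring.
  rewrite mulrC ler_pM2l//.
  apply: (@le_trans _ _ (32 / ln 2 * 4^-1 * (2^-1 * t) * L)).
    have -> : 32 / ln 2 * 4^-1 * (2^-1 * t) * L = 4 * ((t * L) / ln 2).
      by field; rewrite gt_eqF.
    by rewrite -[leLHS]mulr1 ler_pM2l// ler_pdivlMr// mul1r.
  rewrite ler_pM2r//; apply: ler_pM => //.
  + by rewrite mulr_ge0// divr_ge0// ltW.
  + by rewrite mulr_ge0// ltW.
  + by rewrite ler_pM2l// divr_gt0.
have Lv : 0 < ln m%:R * v m by rewrite mulr_gt0.
rewrite -lerBrDl ler_pdivrMr//; apply: (le_trans step).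
rewrite sumrB -mulr_sumr mulrBr mulrBl mul1r.
have -> : Phi J m * (ln m%:R * v m) = kappa * (ln m%:R * \sum_(0 <= j < J.+1) V j m).
  by rewrite /Phi; field; rewrite gt_eqF.
by rewrite lerD2l lerN2.
Qed.

(** Downward induction on m from N: visits are at most steps, and each step costs 1 by
    [lyapunov_drop]. The leading 1 absorbs the indicator of [A]. *)
Lemma hits_le_lyapunov A N m : (1 < m <= N)%N ->
  1 + hits p A N m <= Phi (trunc_log 2 (trunc_log 2 N)) m.
Proof.
have kp := mangoldt_div_kernel.
have [j] := ubnP (N - m)%N; elim: j m => // j IH m mj /andP[m1 mN].
apply: le_trans (lyapunov_drop N m1 _); last first.
  by apply: leq_trunc_log; exact: leq_trunc_log.
rewrite lerD2l hitsE//; apply: ler_sum_nat => k /andP[k0 kN].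
have [mk|mk] := ltnP m k; last first.
  by case: kp => _ p0 _; rewrite p0 ?mul0r// negb_and -leqNgt mk.
rewrite ler_wpM2l//; first by case: kp.
apply: le_trans (IH k _ _); [|lia|lia].
by rewrite lerD2r; case: (k \in A).
Qed.

Lemma lyapunov_le J m : (1 < m)%N -> Phi J m <= kappa * J.+1%:R.
Proof.
move=> m1; rewrite ler_pM2l// ler_pdivrMr ?weight_gt0//.
apply: (@le_trans _ _ (\sum_(0 <= j < J.+1) v m)).
  by apply: ler_sum => j _; have /andP[] := V_bounds j m1.
by rewrite big_const_nat iter_addr_0 subn0 mulr_natl.
Qed.

(** The Lyapunov bound needs m > 1, so one step is taken first; every later vertex exceeds 1. *)
Lemma hits_le A N m : (0 < m)%N ->
  hits p A N m <= kappa * (trunc_log 2 (trunc_log 2 N)).+1%:R.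
Proof.
have kp := mangoldt_div_kernel; move=> m0; set J := trunc_log _ _.
have B0 : 0 <= kappa * J.+1%:R by rewrite mulr_ge0// ltW.
rewrite hitsE//; apply: (@le_trans _ _ (\sum_(1 <= k < N.+1) p m k * (kappa * J.+1%:R))).
  apply: ler_sum_nat => k /andP[k0 kN].
  have [mk|mk] := ltnP m k; last first.
    by case: kp => _ p0 _; rewrite p0 ?mul0r// negb_and -leqNgt mk.
  rewrite ler_wpM2l//; first by case: kp.
  have k1 : (1 < k)%N by lia.
  apply: le_trans (lyapunov_le J k1).
  apply: le_trans (@hits_le_lyapunov A N k _); last by rewrite k1.
  by rewrite lerD2r; case: (k \in A).
by rewrite -mulr_suml -[leRHS]mul1r ler_wpM2r//; case: kp => _ _; apply.
Qed.

Lemma hits_le_ln_ln : exists (C : R) (N0 : nat), 0 < C /\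
  forall A N m, (N0 <= N)%N -> (0 < m)%N -> hits p A N m <= C * ln (ln N%:R).
Proof.
have [X hX] := ln_ln_large (1 : R).
(* J ln 2 <= ln ln N - ln ln 2, and ln ln N >= 1 here, so the additive constants are absorbed into
   c. *)
pose c : R := (ln 2)^-1 + `|ln (ln (2 : R))| / ln 2 + 1.
have c0 : 0 < c.
  by rewrite /c ltr_wpDl// addr_ge0 ?divr_ge0 ?invr_ge0 ?(ltW l2).
exists (kappa * c), (maxn X 2); split; first by rewrite mulr_gt0.
move=> A N m; rewrite geq_max => /andP[XN N2] m0.
apply: (le_trans (hits_le A N m0)); rewrite -mulrA ler_pM2l//.
have LL1 := hX N XN; set LL := ln (ln _) in LL1 *.
have [t1 _] := trunc_log_bounds R N2; set J := trunc_log _ _ in t1 *.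
have : J%:R * ln 2 + ln (ln 2) <= LL.
  have -> : J%:R * ln 2 = ln ((2 ^ J)%N%:R : R) by rewrite natrX lnXn// mulr_natl.
  by rewrite -lnM ?posrE ?ltr0n ?expn_gt0// ler_ln// posrE ?ln0// mulr_gt0 ?ltr0n ?expn_gt0.
have : - `|ln (ln (2 : R))| <= ln (ln 2) by rewrite lerNl -normrN ler_norm.
set a := `|_|; set b := ln (ln 2) => h1 h2.
have a0 : 0 <= a by exact: normr_ge0.
have h3 : J%:R <= (LL + a) / ln 2 by rewrite ler_pdivlMr//; lra.
rewrite -(natr1 J); apply: (le_trans (lerD h3 (lexx _))).
rewrite /c mulrDl -/a.
have : 0 <= a / ln 2 * (LL - 1).
  by rewrite mulr_ge0 ?subr_ge0 ?divr_ge0 ?(ltW l2).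
by lra.
Qed.

(** For m < k dividing k, flow(m) p(m, k) = Lambda(k/m) v(k), so the visit recursion without exit
    amounts to the values Lambda(k/m) over m | k summing to ln k. *)
Lemma flowE k N : (0 < k <= N)%N ->
  flow v k = (k == 1%N)%:R + \sum_(1 <= m < N.+1) (predT m)%:R * flow v m * p m k.
Proof.
move=> kN; have /andP[k0 _] := kN; rewrite {1}/flow.
have [->|k1] := eqVneq k 1%N.
  rewrite big1_seq ?addr0// => m; rewrite mem_index_iota => /andP[_ /andP[m0 _]].
  by rewrite /p /mangoldt_kernel ltnNge m0 mulr0.
rewrite add0r -(sum_mangoldt_cofactor R kN) mulr_suml [LHS]big_mkcond.
apply: eq_big_nat => m /andP[m0 mN]; rewrite mul1r /p /mangoldt_kernel.
case: (boolP (m %| k)%N) => mk; last by rewrite andbF mulr0.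
rewrite andbT; case: ltnP => h.
  by field; rewrite gt_eqF// flow_gt0.
have := dvdn_leq k0 mk => h'; have -> : k = m by lia.
by rewrite divnn m0 mangoldt1 mul0r mulr0.
Qed.

(** Duality with nowhere to exit: for f the indicator of [A] plus [hits], f minus its average after
    one step is the indicator. The start 1 cancels on both sides. *)
Lemma hits_from1 A N : (0 < N)%N ->
  hits p A N 1 = \sum_(2 <= a < N.+1 | a \in A) ln a%:R * v a.
Proof.
have kp := mangoldt_div_kernel; move=> N0.
have := @kernel_duality _ p (flow v) predT 1 N
  (fun m => (m \in A)%:R + hits p A N m) _ (fun k => @flowE k N).
rewrite N0 => /(_ isT).
rewrite [X in _ = _ - X]big1 ?subr0; last by move=> i _; rewrite !mul0r.
rewrite big_ltn//= mul1r -hitsE// addrK {1}/flow eqxx mul1r => /addrI <-.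
rewrite [RHS]big_mkcond; apply: eq_big_nat => a /andP[a1 _].
rewrite mul1r -hitsE// addrK /flow; have -> : (a == 1%N) = false by lia.
by case: (a \in A); rewrite ?mulr1 ?mulr0.
Qed.

(** The lower bound on v costs 2/(a ln^2 a) at each a, and the sum of these is bounded by
    telescoping 1/ln a, independently of [A] and N. *)
Lemma hits_from1_ge : exists B : R, forall A N, (1 < N)%N ->
  \sum_(2 <= a < N.+1 | a \in A) (a%:R * ln (a%:R : R))^-1 - B <= hits p A N 1.
Proof.
exists (2 * ((2 * ln 2 ^+ 2)^-1 + (ln 2)^-1)) => A N N1.
rewrite hits_from1; last by lia.
have tail : \sum_(2 <= a < N.+1) (a%:R * ln (a%:R : R) ^+ 2)^-1 <=
    (2 * ln 2 ^+ 2)^-1 + (ln 2)^-1 - (ln (N%:R : R))^-1.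
  elim: N N1 => // N IH N1; have [->|N2] := eqVneq N 1%N.
    by rewrite big_nat1; lra.
  rewrite big_nat_recr//=; have {}N1 : (1 < N)%N by lia.
  apply: (le_trans (lerD (IH N1) (lexx _))).
  have h := @ln_pred_le R N.+1 (ltnW N1); rewrite /= in h.
  have L0 := ln0 N1; have L1 := @ln0 N.+1 (ltnW N1).
  have LL : ln (N%:R : R) <= ln N.+1%:R by rewrite ler_ln ?posrE ?ltr0n ?ler_nat//; lia.
  set a := ln N%:R in h L0 LL *; set b := ln _ in h L1 LL *.
  have -> : (N.+1%:R * b ^+ 2)^-1 = N.+1%:R^-1 / b ^+ 2 by rewrite invfM.
  have h1 : N.+1%:R^-1 / b ^+ 2 <= (b - a) / b ^+ 2.
    by rewrite ler_pM2r// invr_gt0 exprn_gt0.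
  have h2 : (b - a) / b ^+ 2 <= (b - a) / (a * b).
    rewrite ler_wpM2l ?subr_ge0// lef_pV2 ?posrE ?mulr_gt0 ?exprn_gt0//.
    by rewrite expr2 ler_pM2r.
  have h3 : (b - a) / (a * b) = a^-1 - b^-1 by field; rewrite !gt_eqF.
  move: (le_trans h1 h2); rewrite h3; set u := _ / b ^+ 2; set a' := a^-1; set b' := b^-1.
  by set w := (2 * _)^-1 + (ln 2)^-1; lra.
have : (ln (N%:R : R))^-1 > 0 by rewrite invr_gt0 ln0.
move=> lN; rewrite lerBlDr.
apply: (@le_trans _ _ (\sum_(2 <= a < N.+1 | a \in A)
    (ln a%:R * v a + 2 * (a%:R * ln (a%:R : R) ^+ 2)^-1))).
  rewrite big_nat_cond [leRHS]big_nat_cond; apply: ler_sum => a /andP[/andP[a1 _] _].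
  have /andP[h _] := v_bounds a1; have L0 := ln0 a1.
  have a0 : 0 < (a%:R : R) by rewrite ltr0n; lia.
  have : ln a%:R * (a%:R^-1 * (ln a%:R ^- 2 - 2 / ln a%:R ^+ 3)) <= ln (a%:R : R) * v a.
    by rewrite ler_pM2l.
  have -> : ln (a%:R : R) * (a%:R^-1 * (ln a%:R ^- 2 - 2 / ln a%:R ^+ 3)) =
     (a%:R * ln a%:R)^-1 - 2 * (a%:R * ln a%:R ^+ 2)^-1.
    by field; rewrite !gt_eqF.
  lra.
rewrite big_split/= lerD2l.
apply: (@le_trans _ _ (\sum_(2 <= a < N.+1) 2 * (a%:R * ln (a%:R : R) ^+ 2)^-1)).
  rewrite big_mkcond; apply: ler_sum => a _; case: ifP => // _.
  by rewrite mulr_ge0// invr_ge0 mulr_ge0// sqr_ge0.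
by rewrite -mulr_sumr; lra.
Qed.

End kernel.

Lemma divisibility_walk (R : realType) : exists (p : nat -> nat -> R) (C B : R) (N0 : nat),
  [/\ div_kernel p, 0 < C,
    forall A N m, (N0 <= N)%N -> (0 < m)%N -> hits p A N m <= C * ln (ln N%:R) &
    forall A N, (1 < N)%N ->
      \sum_(2 <= a < N.+1 | a \in A) (a%:R * ln (a%:R : R))^-1 - B <= hits p A N 1].
Proof.
have [v [V [h1 h2 h3 h4 h5]]] := kernel_weights R.
have [C [N0 [C0 hC]]] := hits_le_ln_ln h1 h2 h3 h4 h5.
have [B hB] := hits_from1_ge h1 h2 h3 h4 h5.
exists (mangoldt_kernel v), C, B, N0; split => //.
exact: mangoldt_div_kernel h2 h3 h4 h5.
Qed.

(** * Limsups and infinite chains *)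


Lemma limsup_pinfty_gt (R : realType) (f : R -> R) (r : R) :
  (r%:E < limsup_pinfty f)%E -> forall y, exists2 x, y < x & r < f x.
Proof.
move=> h y; apply: contrapT => Hno.
move: h; rewrite ltNge => /negP; apply.
apply: (@le_trans _ _ (ereal_sup ((fun x : R => (f x)%:E) @` [set x | y < x]))).
  by apply: ereal_inf_lbound; exists [set x | y < x] => //; exists y; split => //; exact: num_real.
apply: ge_ereal_sup => _ [x /= yx <-]; rewrite lee_fin leNgt; apply/negP => rx.
by apply: Hno; exists x.
Qed.

Lemma limsup_pinfty_ge (R : realType) (f : R -> R) (D : R) :
  (forall r y, r < D -> exists2 x, y < x & r <= f x) -> (D%:E <= limsup_pinfty f)%E.
Proof.
move=> H; apply: le_ereal_inf_tmp => _ [W [M [_ MW]] <-].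
apply/lee_subgt0Pr => e e0.
have De : D - e < D by lra.
have [x Mx fx] := H (D - e) M De.
apply: (@le_trans _ _ (f x)%:E); first by rewrite -EFinB lee_fin.
by apply: ereal_sup_ubound; exists x => //; exact: MW.
Qed.

Lemma harm_log_sum_trunc (R : realType) A (x : R) : 0 <= x ->
  harm_log_sum A x =
  \sum_(2 <= a < (Num.truncn x).+1 | a \in A) (a%:R * ln (a%:R : R))^-1.
Proof.
move=> x0; rewrite /harm_log_sum big_nat_cond [RHS]big_nat_cond; apply: eq_bigl => a.
case: (boolP (2 <= a < _)%N) => //= /andP[_ ax].
rewrite (_ : (a%:R <= x) = true) ?andbT//.
by apply: (@le_trans _ _ (Num.truncn x)%:R); rewrite ?truncn_le// ler_nat -ltnS.
Qed.

Lemma path_le_last x l a : path dvd_lt x l -> a \in l -> (a <= last x l)%N.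
Proof.
elim: l x => //= b l IH x /andP[_ bl]; rewrite inE => /orP[/eqP ->|al].
  by have := path_size_last bl; lia.
exact: IH.
Qed.

(** [count_le] inspects only indices up to y, whence the requirement s <= y. *)
Lemma count_le_ge (R : realType) (n : nat -> nat) (s y : nat) :
  (s <= y)%N -> (forall i, (i < s)%N -> (n i <= y)%N) ->
  (s%:R : R) <= count_le n (y%:R : R).
Proof.
move=> sy ny; rewrite /count_le natrK ler_nat (big_cat_nat (n:=s))//=; last by lia.
apply: leq_trans (leq_addr _ _); rewrite big_nat_cond.
rewrite (eq_bigl (fun i => (0 <= i < s)%N && true)).
  by rewrite -big_nat_cond sum_nat_const_nat subn0 muln1.
move=> i; case: (boolP (0 <= i < s)%N) => //= is'.
by rewrite ler_nat ny.
Qed.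

Lemma div_chain_cat A x l m l' : div_chain A x l -> (last x l %| m)%N -> (0 < m)%N ->
  div_chain A m l' -> div_chain A x (l ++ l').
Proof.
rewrite /div_chain cat_path all_cat => /andP[-> ->] lm m0 /andP[ml ->].
rewrite /= !andbT; case: l' ml => //= a l' /andP[/andP[ma dma] ->]; rewrite andbT.
apply/andP; split; last exact: dvdn_trans dma.
by apply: leq_ltn_trans ma; exact: dvdn_leq.
Qed.

(** Iterates the extension over states (stage k, chain so far, current vertex). The block added at
    stage k lies below some y and alone has at least (D - e_k) ln ln y entries, so earlier blocks
    need not be counted. *)
Lemma chain_from_extensions (R : realType) A (D : R) (P : nat -> Prop) : 0 < D ->
  P 1%N ->
  (forall n0 e Y, (0 < n0)%N -> P n0 -> 0 < e < D ->
    exists m l y, [/\ (0 < m)%N, P m, div_chain A n0 l, (last n0 l %| m)%N &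
     (m <= y)%N /\ (Y <= y)%N /\ (D - e) * ln (ln y%:R) <= (size l)%:R]) ->
  exists n : nat -> nat, [/\ forall i, A (n i), forall i, dvd_lt (n i) (n i.+1) &
    forall r (y : R), r < D -> exists2 x, y < x & r <= count_le n x / ln (ln x)].
Proof.
move=> D0 P1 ext.
have [X1 hX1] := ln_ln_large (1 : R).
pose inv (s : nat * seq nat * nat) :=
  [/\ (0 < s.2)%N, P s.2, div_chain A 1 s.1.2 & (last 1%N s.1.2 %| s.2)%N].
pose e (k : nat) : R := D / k.+2%:R.
have eD k : 0 < e k < D.
  by rewrite divr_gt0// ltr_pdivrMr// ltr_pMr// ltr1n.
pose next (s s' : nat * seq nat * nat) := inv s ->
  [/\ inv s', s'.1.1 = s.1.1.+1 & exists l y, [/\ s'.1.2 = s.1.2 ++ l,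
    (s'.2 <= y)%N, (maxn X1 s.1.1 <= y)%N & (D - e s.1.1) * ln (ln y%:R) <= (size l)%:R]].
have step s : exists s', next s s'.
  case: s => [[k L] m]; have [[/= m0 Pm hL Lm]|ninv] := pselect (inv (k, L, m)); last first.
    by exists (k, L, m).
  have [m' [l [y [m'0 Pm' hl lm' [my [Yy size_l]]]]]] := ext m (e k) (maxn X1 k) m0 Pm (eD k).
  exists (k.+1, L ++ l, m') => _; split => //=.
    split => //=; first exact: div_chain_cat hl.
    rewrite last_cat; case: l hl lm' {size_l} => //= hl lm'.
    exact: dvdn_trans lm'.
  by exists l, y.
have [F [F0 FS]] := dependent_choice (fun s => cid (step s)) (0%N, [::], 1%N).
have invF k : inv (F k).
  elim: k => [|k IH]; first by rewrite F0; split.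
  by have [] := FS k IH.
have Fk k : (F k).1.1 = k.
  by elim: k => [|k IH]; [rewrite F0|have [_ -> _] := FS k (invF k); rewrite IH].
pose L k := (F k).1.2.
have LS k : exists l y, [/\ L k.+1 = L k ++ l, ((F k.+1).2 <= y)%N, (maxn X1 k <= y)%N &
    (D - e k) * ln (ln y%:R) <= (size l)%:R].
  by have [_ _] := FS k (invF k); rewrite Fk.
(* Every stage adds an entry, because ln ln y >= 1 makes the new block nonempty. *)
have sizeL k : (k <= size (L k))%N.
  elim: k => // k IH; have [l [y [-> _ ky hl]]] := LS k.
  rewrite size_cat; suff : (0 < size l)%N by lia.
  move: ky; rewrite geq_max => /andP[Xy _].
  rewrite -(ltr0n R); apply: lt_le_trans hl.
  have /andP[_ h] := eD k; rewrite mulr_gt0 ?subr_gt0//.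
  by apply: lt_le_trans (hX1 _ Xy).
have prefixL j k i : (j <= k)%N -> (i < size (L j))%N -> nth 0%N (L k) i = nth 0%N (L j) i.
  move=> /subnK <-; elim: (k - j)%N => // d IH ij.
  have [l [y [-> _ _ _]]] := LS (d + j)%N.
  rewrite nth_cat; case: ltnP => [_|h]; first exact: IH.
  suff : (size (L j) <= size (L (d + j)))%N by lia.
  elim: d {IH h y l} => // d IH; have [l [y [-> _ _ _]]] := LS (d + j)%N.
  by rewrite size_cat; lia.
(* Stage i + 1 already has more than i entries, so the default 0 is never read; later stages only
   append. *)
pose n i := nth 0%N (L i.+1) i.
have nE k i : (i < size (L k))%N -> n i = nth 0%N (L k) i.
  move=> ik; have [h|h] := leqP i.+1 k.
    by rewrite /n (prefixL i.+1 k).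
  by rewrite /n (prefixL k i.+1)// ltnW.
have chainL k : div_chain A 1 (L k) by case: (invF k).
exists n; split.
- move=> i; have /andP[_ /allP h] := chainL i.+1.
  by apply/set_mem/h/mem_nth/sizeL.
- move=> i; have s2 := sizeL i.+2; have /andP[h _] := chainL i.+2.
  rewrite (nE i.+2 i) ?(nE i.+2 i.+1)//; last exact: ltnW.
  by have /(pathP 0%N)/(_ i.+1 s2) := h.
- move=> r y rD.
  (* k > y puts the witness z beyond y; k > D/(D - r) gives e_k <= D - r. *)
  pose k := (Num.truncn (Num.max y (D / (D - r)))).+1.
  have hk : Num.max y (D / (D - r)) < k%:R by exact: truncnS_gt.
  move: hk; rewrite gt_max => /andP[yk rk].
  have [l [z [Ll mz kz hl]]] := LS k.
  move: kz; rewrite geq_max => /andP[Xz kz].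
  have LL1 := hX1 _ Xz.
  exists z%:R; first by apply: lt_le_trans yk _; rewrite ler_nat.
  rewrite ler_pdivlMr; last exact: lt_le_trans LL1.
  apply: (@le_trans _ _ ((D - e k) * ln (ln z%:R))).
    rewrite ler_pM2r; last exact: lt_le_trans LL1.
    rewrite lerBrDr addrC -lerBrDr /e ler_pdivrMr//.
    move: rk; rewrite ltr_pdivrMr ?subr_gt0// => rk.
    have : k%:R <= k.+2%:R :> R by rewrite ler_nat; lia.
    have : 0 < D - r by rewrite subr_gt0.
    by nra.
  apply: (le_trans hl); apply: (@le_trans _ _ (size (L k.+1))%:R).
    by rewrite ler_nat Ll size_cat leq_addl.
  have [m0 _ _ Lm] := invF k.+1; have lm := dvdn_leq m0 Lm.
  have /andP[pL _] := chainL k.+1.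
  apply: count_le_ge.
    by have := path_size_last pL; rewrite /L in lm *; lia.
  move=> i iL; rewrite (nE k.+1)//; apply: leq_trans mz; apply: leq_trans lm.
  by apply: path_le_last => //; exact: mem_nth.
Qed.

Theorem theorem1p6 (R : realType) (A : set nat) :
  A `<=` [set a | (0 < a)%N] ->
  (0 < Delta R A)%E ->
  exists n : nat -> nat,
    (forall i, A (n i)) /\
    (forall i, (n i %| n i.+1)%N) /\
    (forall i, (n i < n i.+1)%N) /\
    (Delta R A <= limsup_pinfty (fun x : R => (count_le n x / ln (ln x))%R))%E.
Proof.
move=> _ D0.
have [p [C [B [N0 [kp C0 hC hB]]]]] := divisibility_walk R.
have [X1 hX1] := ln_ln_large (1 : R).
(* Passing from x to its integer part keeps the sum over [A] and can only decrease ln ln. *)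
have trunc_ln (x : R) : (maxn X1 2)%:R < x ->
    let N := Num.truncn x in [/\ (X1 <= N)%N, (1 < N)%N, 1 <= ln (ln (N%:R : R)) &
      ln (ln (N%:R : R)) <= ln (ln x)].
  move=> hx N; have x0 : 0 <= x by apply: le_trans (ltW hx).
  have : (maxn X1 2 <= N)%N by rewrite /N truncn_ge_nat// ltW.
  rewrite geq_max => /andP[XN N2]; split => //; first exact: hX1.
  have N1 : 1 < (N%:R : R) by rewrite ltr1n.
  have Nx : N%:R <= x by rewrite truncn_le.
  by rewrite ler_ln ?posrE ?ln_gt0 ?ler_ln ?posrE//; lra.
have harm_le (x : R) : (maxn X1 2)%:R < x ->
    harm_log_sum A x - B <= hits p A (Num.truncn x) 1.
  move=> hx; have [_ N2 _ _] := trunc_ln x hx.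
  by rewrite harm_log_sum_trunc ?hB//; apply: le_trans (ltW hx).
(* An infinite limsup would exceed C + |B|, contrary to [hC] and [hB] for the walk started at 1. *)
have Dfin : Delta R A \is a fin_num.
  rewrite ge0_fin_numE ?ltW// ltNge; apply/negP => Dinf.
  have CB : ((C + `|B|)%:E < Delta R A)%E by apply: lt_le_trans Dinf; rewrite ltry.
  have [x hx] := limsup_pinfty_gt CB (maxn N0 (maxn X1 2))%:R.
  apply/negP; rewrite -leNgt.
  have hx2 : (maxn X1 2)%:R < x by apply: le_lt_trans hx; rewrite ler_nat leq_maxr.
  have [XN N2 LL1 LLx] := trunc_ln x hx2.
  have N0N : (N0 <= Num.truncn x)%N.
    rewrite truncn_ge_nat; last by apply: le_trans (ltW hx).
    by apply: le_trans (ltW hx); rewrite ler_nat leq_maxl.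
  rewrite ler_pdivrMr; last by lra.
  have := harm_le x hx2; have := hC A (Num.truncn x) 1%N N0N isT.
  have : C * ln (ln (Num.truncn x)%:R) <= C * ln (ln x) by rewrite ler_pM2l.
  have : B <= `|B| by exact: ler_norm.
  have : `|B| <= `|B| * ln (ln x) by rewrite -[leLHS]mulr1 ler_wpM2l//; lra.
  by rewrite mulrDl; lra.
pose D := fine (Delta R A).
have DE : Delta R A = D%:E by rewrite /D fineK.
rewrite DE lte_fin in D0.
have g1 : good p A D 1.
  (* For e >= D the required lower bound is at most 0. Otherwise D - e/2 > 0, which allows ln ln x
     to be replaced by ln ln N. *)
  move=> e X e0; have [De|De] := leP D e.
    exists (maxn X X1); first exact: leq_maxl.
    apply: le_trans (hits_ge0 A _ 1 kp).
    rewrite mulr_le0_ge0 ?subr_le0//; apply: le_trans (hX1 _ _) => //.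
    exact: leq_maxr.
  (* Beyond [X2] the constant |B| is at most (e/2) ln ln N. *)
  have [X2 hX2] := ln_ln_large (2 * `|B| / e).
  have De2 : ((D - e / 2)%:E < Delta R A)%E by rewrite DE lte_fin; lra.
  have [x hx rx] := limsup_pinfty_gt De2 (maxn X (maxn X2 (maxn X1 2)))%:R.
  have x0 : 0 <= x by apply: le_trans (ltW hx).
  have := truncn_ge_nat (maxn X (maxn X2 (maxn X1 2))) x0; rewrite (ltW hx).
  rewrite !geq_max => /and3P[XN X2N _].
  have hx2 : (maxn X1 2)%:R < x.
    by apply: le_lt_trans hx; rewrite ler_nat; lia.
  have [XN1 N2 LL1 LLx] := trunc_ln x hx2.
  exists (Num.truncn x) => //.
  move: rx; rewrite ltr_pdivlMr; last by lra.
  have := harm_le x hx2; have := hX2 _ X2N; rewrite ler_pdivrMr//.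
  have : (D - e / 2) * ln (ln (Num.truncn x)%:R) <= (D - e / 2) * ln (ln x).
    by rewrite ler_pM2l//; lra.
  have : B <= `|B| by exact: ler_norm.
  set LN := ln (ln (Num.truncn x)%:R); set Lx := ln (ln x).
  by lra.
have [n [nA ndvd ncount]] := chain_from_extensions D0 g1
  (fun n0 e Y n00 gn0 => @good_extend R p A D C N0 n0 kp C0 (hC A) n00 gn0 e Y).
exists n; split => //; split; first by move=> i; case/andP: (ndvd i).
split; first by move=> i; case/andP: (ndvd i).
by rewrite DE; exact: limsup_pinfty_ge.
Qed.
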